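(* Let $n\ge 1$ and let $$q(t_1,\dots,t_n)=\sum_{k_1,\dots,k_n\ge 0} a_{k_1,\dots,k_n}\,t_1^{k_1}\cdots t_n^{k_n},\qquad a_{0,\dots,0}=0,$$ be a polynomial in $n$ real variables with complex coefficients. Then there exists a random vector $(X_1,\dots,X_n)$ with characteristic function $\varphi(t_1,\dots,t_n)=\mathbb{E}\,e^{i(t_1X_1+\dots+t_nX_n)}$, whose components $X_1,\dots,X_n$ have characteristic functions $\varphi_1,\dots,\varphi_n$ respectively, such that $$\varphi(t_1,\dots,t_n)=\varphi_1(t_1)\cdots\varphi_n(t_n)\exp\big(q(t_1,\dots,t_n)\big)\quad\text{for all } t_1,\dots,t_n\in\mathbb{R},$$ if and only if the following two conditions hold: (i) $q$ contains no monomials depending on only one variable, i.e. $a_{k_1,\dots,k_n}=0$ whenever exactly one of $k_1,\dots,k_n$ is nonzero; (ii) for every multi-index $(k_1,\dots,k_n)$, the coefficient $a_{k_1,\dots,k_n}$ is real if $k_1+\dots+k_n$ is even, and purely imaginary (i.e. lies in $i\mathbb{R}$) if $k_1+\dots+k_n$ is odd.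
   Context: The characteristic function of a random vector $(X_1,\dots,X_n)$ is $\varphi(t_1,\dots,t_n)=\mathbb{E}\exp(i(t_1X_1+\dots+t_nX_n))$, and that of a random variable $X_j$ is $\varphi_j(t)=\mathbb{E}\exp(itX_j)$. (Random variables satisfying the displayed identity for some polynomial $q$ with $q(0,\dots,0)=0$ are called $Q$-independent.) *)

(* Defs.v *)
From HB Require Import structures.
From mathcomp Require Import all_boot all_order all_algebra.
From mathcomp Require Import all_classical all_reals all_analysis.
From mathcomp Require Import complex.
Set Implicit Arguments. Unset Strict Implicit. Unset Printing Implicit Defensive.
Import Order.TTheory GRing.Theory Num.Theory.
Local Open Scope ring_scope.
Local Open Scope complex_scope.

(* E exp(i Y) = E cos Y + i E sin Y, for a real random variable Y *)
Definition cf_of {d} {T : measurableType d} {R : realType}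
  (P : probability T R) (Y : T -> R) : R[i] :=
  Complex (Rintegral P setT (fun w => cos (Y w)))
          (Rintegral P setT (fun w => sin (Y w))).

Definition charfun_vec {d} {T : measurableType d} {R : realType}
  (P : probability T R) (n : nat) (X : 'I_n -> {RV P >-> R}) (t : 'I_n -> R) : R[i] :=
  cf_of P (fun w => \sum_(j < n) t j * X j w).

Definition charfun {d} {T : measurableType d} {R : realType}
  (P : probability T R) (Y : {RV P >-> R}) (s : R) : R[i] :=
  cf_of P (fun w => s * Y w).

Definition cexp {R : realType} (z : R[i]) : R[i] :=
  let: Complex x y := z in Complex (expR x * cos y) (expR x * sin y).

(* A polynomial in n variables of degree < D.+1 in each variable, given by its
   coefficients a_k, k ranging over multi-indices k : 'I_n -> 'I_D.+1.
   Every polynomial is of this form for D large enough. *)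
Definition mpoly_eval {R : realType} (n D : nat)
  (a : {ffun 'I_n -> 'I_D.+1} -> R[i]) (t : 'I_n -> R) : R[i] :=
  \sum_(k : {ffun 'I_n -> 'I_D.+1})
     a k * \prod_(j < n) ((t j)%:C ^+ (nat_of_ord (k j))).

Definition multideg (n D : nat) (k : {ffun 'I_n -> 'I_D.+1}) : nat :=
  \sum_(j < n) nat_of_ord (k j).

Definition cRe {R : Type} (z : complex R) : R := let: Complex x _ := z in x.
Definition cIm {R : Type} (z : complex R) : R := let: Complex _ y := z in y.

(* Main.v *)
(** Necessity: near the origin the characteristic functions do not vanish, and
    [phi (- t)] is the conjugate of [phi t], so [exp (q (- t)) = exp (conj (q t))]
    there; as [q 0 = 0] this gives [q (- t) = conj (q t)], which is (ii).
    Restricting to a coordinate axis gives [exp q = 1] near the origin, hence (i).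

    Sufficiency: choose a positive density [f] on the line whose derivatives satisfy
    [|f^(k)| <= eps^k f]; such an [f] is necessarily band-limited, and is obtained by
    rescaling a sum of two translates of the Fejer kernel.  If [phi] is the Fourier
    transform of [f], that of [f^(k)] is [(- i t)^k phi t].  By (ii), [q] is a
    polynomial in the [- i t_j] with real coefficients.  Under the product measure
    with density [f x_1 ... f x_n], replace every monomial of [exp q] by the product
    of the corresponding ratios [f^(k) / f]: for small [eps] the resulting series is
    a nonnegative weight of total mass 1, and the reweighted measure has
    characteristic function [phi t_1 ... phi t_n exp (q t)].  By (i) its marginals
    have characteristic function [phi]. *)
Require Import Defs.
From HB Require Import structures.
From mathcomp Require Import all_boot all_order all_algebra.
From mathcomp Require Import all_classical all_reals all_analysis.
From mathcomp Require Import complex.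
From mathcomp Require Import measurable_realfun zify ring lra.
Set Implicit Arguments. Unset Strict Implicit. Unset Printing Implicit Defensive.
Import Order.TTheory GRing.Theory Num.Theory.
Import numFieldNormedType.Exports.
Local Open Scope classical_set_scope.
Local Open Scope ring_scope.
Local Open Scope complex_scope.

Local Notation Re := complex.Re.
Local Notation Im := complex.Im.

Section complex_norm.
Context {R : realType}.
Implicit Types (z w : R[i]) (x : R).

Lemma normc_real x : `|x%:C| = `|x|%:C.
Proof. by rewrite normc_def/= expr0n addr0 sqrtr_sqr. Qed.

Lemma normc_i : `|'i%C : R[i]| = 1.
Proof. by rewrite normc_def/= expr0n expr1n add0r sqrtr1. Qed.

Lemma normc_ge_Im z : `|Im z|%:C <= `|z|.
Proof.
by have := normc_ge_Re (z * 'i%C); rewrite ReiNIm normrN normrM normc_i mulr1.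
Qed.

Lemma ReM z w : Re (z * w) = Re z * Re w - Im z * Im w.
Proof. by case: z w => [? ?] []. Qed.

Lemma ImM z w : Im (z * w) = Re z * Im w + Im z * Re w.
Proof. by case: z w => [? ?] []. Qed.

Lemma cvgc_dist_le {T : Type} {F : set_system T} {FF : Filter F}
    (f : T -> R[i]) (l : R[i]) (e : T -> R) :
  e x @[x --> F] --> 0 -> (forall t, `|l - f t| <= (e t)%:C) ->
  (f x : R[i]^o) @[x --> F] --> (l : R[i]^o).
Proof.
move=> /cvgr0Pnorm_lt e_cvg0 fe; apply/cvgrPdist_lt => r r_gt0.
have rE : (Re r)%:C = r by rewrite RRe_real// gtr0_real.
rewrite -rE ltcR in r_gt0 *; near=> x.
rewrite (le_lt_trans (fe x))// ltcR (le_lt_trans (ler_norm _))//.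
by near: x; exact: e_cvg0.
Unshelve. all: by end_near. Qed.

Lemma cvg_real_complex {T : Type} {F : set_system T} {FF : Filter F}
    (f : T -> R) (l : R) :
  f x @[x --> F] --> l -> ((f x)%:C : R[i]^o) @[x --> F] --> (l%:C : R[i]^o).
Proof.
move=> fl; apply: (@cvgc_dist_le _ _ _ _ _ (fun t => `|l - f t|)) => [|t].
  rewrite -(normr0 R) -(subrr l); apply: cvg_norm.
  by apply: cvgB fl; exact: cvg_cst.
by rewrite -rmorphB normc_real.
Qed.

Lemma cvg_complexP {T : Type} {F : set_system T} {FF : Filter F}
    (f : T -> R[i]) (l : R[i]) :
  (f x : R[i]^o) @[x --> F] --> (l : R[i]^o) <->
  (Re (f x) @[x --> F] --> Re l) /\ (Im (f x) @[x --> F] --> Im l).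
Proof.
split=> [/cvgrPdist_lt fl|[fRe fIm]].
  split; apply/cvgrPdist_lt => e e_gt0; near=> x.
  - rewrite -ltcR -raddfB (le_lt_trans (normc_ge_Re _))//.
    by near: x; apply: fl; rewrite ltcR.
  - rewrite -ltcR -raddfB (le_lt_trans (normc_ge_Im _))//.
    by near: x; apply: fl; rewrite ltcR.
rewrite [l]complexE; under eq_fun do rewrite [f _]complexE.
apply: cvgD; first exact: cvg_real_complex.
by apply: cvgMl_tmp; exact: cvg_real_complex.
Unshelve. all: by end_near. Qed.

Lemma cvgc_unique {T : Type} {F : set_system T} {FF : ProperFilter F}
    (f : T -> R[i]) (l m : R[i]) :
  (f x : R[i]^o) @[x --> F] --> (l : R[i]^o) ->
  (f x : R[i]^o) @[x --> F] --> (m : R[i]^o) -> l = m.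
Proof. by apply: cvg_unique; exact: norm_hausdorff. Qed.

End complex_norm.

Section unit_circle.
Context {R : realType}.
Implicit Types x y : R.

Definition cis x : R[i] := cos x +i* sin x.

Lemma cis0 : cis 0 = 1.
Proof. by rewrite /cis cos0 sin0. Qed.

Lemma cisD x y : cis (x + y) = cis x * cis y.
Proof. by rewrite /cis cosD sinD; simpc; rewrite [sin x * _ + _]addrC. Qed.

Lemma cisN x : cis (- x) = conjc (cis x).
Proof. by rewrite /cis cosN sinN. Qed.

Lemma norm_cis x : `|cis x| = 1.
Proof. by rewrite normc_def/= cos2Dsin2 sqrtr1. Qed.

Lemma cis_sum (I : Type) (s : seq I) (f : I -> R) :
  cis (\sum_(i <- s) f i) = \prod_(i <- s) cis (f i).
Proof. exact: (big_morph cis cisD cis0). Qed.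

End unit_circle.

Section real_integral.
Context {d : measure_display} {T : measurableType d} {R : realType}.

Lemma integrable_norm_le (mu : {measure set T -> \bar R}) (f g : T -> R) :
  mu.-integrable setT (EFin \o g) -> measurable_fun setT f ->
  (forall x, `|f x| <= g x) -> mu.-integrable setT (EFin \o f).
Proof.
move=> ig mf fg; apply: (le_integrable measurableT _ _ ig).
  exact/measurable_EFinP.
by move=> x _ /=; rewrite lee_fin (le_trans (fg x))// ler_norm.
Qed.

Lemma integrable_bounded (P : {finite_measure set T -> \bar R}) (f : T -> R) M :
  measurable_fun setT f -> (forall x, `|f x| <= M) ->
  P.-integrable setT (EFin \o f).
Proof.
by move=> mf; apply: integrable_norm_le mf; exact: finite_measure_integrable_cst.
Qed.

Lemma Rintegral_cvg (mu : {measure set T -> \bar R}) (f_ : nat -> T -> R)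
    (f g : T -> R) :
  (forall n, measurable_fun setT (f_ n)) -> measurable_fun setT f ->
  (forall x, f_ ^~ x @ \oo --> f x) -> mu.-integrable setT (EFin \o g) ->
  (forall n x, `|f_ n x| <= g x) ->
  \int[mu]_x f_ n x @[n --> \oo] --> \int[mu]_x f x.
Proof.
move=> mf_ mf f_f ig f_g.
have [intf _ cvg_int] : [/\ mu.-integrable setT (EFin \o f),
    [sequence \int[mu]_x `|(f_ n x)%:E - (f x)%:E|]_n @ \oo --> 0%E &
    [sequence \int[mu]_x (f_ n x)%:E]_n @ \oo --> \int[mu]_x (f x)%:E]%E.
  apply: (@dominated_convergence _ _ _ mu setT measurableT (fun n => EFin \o f_ n)
    (EFin \o f) (EFin \o g)) => //.
  - by move=> n; exact/measurable_EFinP.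
  - exact/measurable_EFinP.
  - by apply: aeW => x _; apply: cvg_EFin; [exact: nearW|exact: f_f].
  - by apply: aeW => x n _; rewrite lee_fin f_g.
by apply: fine_cvg; rewrite fineK//; exact: integrable_fin_num.
Qed.

Lemma Rintegral_probability_cst (P : probability T R) (r : R) :
  \int[P]_x r = r.
Proof.
rewrite Rintegral_cst// -[RHS]mulr1; congr (_ * _).
exact: (congr1 fine (probability_setT P)).
Qed.

End real_integral.

Section real_product_integral.
Context {d1 d2 : measure_display} {T1 : measurableType d1}
  {T2 : measurableType d2} {R : realType}.
Variables (mu1 : {sigma_finite_measure set T1 -> \bar R})
  (mu2 : {sigma_finite_measure set T2 -> \bar R}).
Variables (f : T1 -> R) (g : T2 -> R).
Hypotheses (intf : mu1.-integrable setT (EFin \o f))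
  (intg : mu2.-integrable setT (EFin \o g)).

Lemma integrable_tensor :
  (mu1 \x mu2)%E.-integrable setT (fun w => (f w.1 * g w.2)%:E).
Proof.
have mf : measurable_fun setT f by exact/measurable_EFinP/(measurable_int mu1).
have mg : measurable_fun setT g by exact/measurable_EFinP/(measurable_int mu2).
apply/integrable12ltyP.
  by apply/measurable_EFinP/measurable_funM; exact: measurableT_comp.
under eq_integral => x _.
  under eq_integral => y _ do rewrite /= normrM EFinM.
  rewrite ge0_integralZl//; last first.
    by apply/measurable_EFinP; exact: measurableT_comp.
  over.
rewrite ge0_integralZr//.
- apply: lte_mul_pinfty => //; last by case/integrableP: intg.
    exact: integral_ge0.
  exact: (integrable_fin_num _ (integrable_norm intf)).
- by apply/measurable_EFinP; exact: measurableT_comp.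
- exact: integral_ge0.
Qed.

Lemma Rintegral_tensor :
  \int[(mu1 \x mu2)%E]_w (f w.1 * g w.2) = \int[mu1]_x f x * \int[mu2]_y g y.
Proof.
rewrite /Rintegral -(integral12_prod_meas1 integrable_tensor) /fubini_F/=.
under eq_integral => x _.
  under eq_integral do rewrite EFinM.
  rewrite integralZl// -(fineK (integrable_fin_num _ intg))// muleC; over.
by rewrite integralZl// fineM ?integrable_fin_num//= mulrC.
Qed.

End real_product_integral.

Section complex_integral.
Context {d : measure_display} {T : measurableType d} {R : realType}.
Implicit Types (mu : {measure set T -> \bar R}) (f g : T -> R[i]) (M : R).

Definition Cmeasurable f :=
  measurable_fun setT (fun x => Re (f x)) /\
  measurable_fun setT (fun x => Im (f x)).

Definition Cintegrable mu f :=
  mu.-integrable setT (EFin \o (fun x => Re (f x))) /\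
  mu.-integrable setT (EFin \o (fun x => Im (f x))).

Definition Cintegral mu f : R[i] := \int[mu]_x Re (f x) +i* \int[mu]_x Im (f x).

Lemma cf_ofE (P : probability T R) (Y : T -> R) :
  cf_of P Y = Cintegral P (fun x => cis (Y x)).
Proof. by []. Qed.

Lemma Cmeasurable_real (h : T -> R) :
  measurable_fun setT h -> Cmeasurable (fun x => (h x)%:C).
Proof. by move=> mh; split => //=; exact: measurable_cst. Qed.

Lemma Cmeasurable_cis (Y : T -> R) :
  measurable_fun setT Y -> Cmeasurable (fun x => cis (Y x)).
Proof.
move=> mY; split; apply: measurableT_comp mY; apply: continuous_measurable_fun.
- exact: continuous_cos.
- exact: continuous_sin.
Qed.

Lemma CmeasurableM f g :
  Cmeasurable f -> Cmeasurable g -> Cmeasurable (fun x => f x * g x).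
Proof.
move=> [mRef mImf] [mReg mImg]; split.
- under eq_fun do rewrite ReM; apply: measurable_funB; exact: measurable_funM.
- under eq_fun do rewrite ImM; apply: measurable_funD; exact: measurable_funM.
Qed.

Lemma Cintegrable_norm_le mu f (g : T -> R) :
  mu.-integrable setT (EFin \o g) -> Cmeasurable f ->
  (forall x, `|f x| <= (g x)%:C) -> Cintegrable mu f.
Proof.
move=> ig [mRe mIm] fg; split; apply: integrable_norm_le ig _ _ => // x.
- by rewrite -lecR (le_trans (normc_ge_Re _)).
- by rewrite -lecR (le_trans (normc_ge_Im _)).
Qed.

Lemma Cintegrable_bounded (P : {finite_measure set T -> \bar R}) f M :
  Cmeasurable f -> (forall x, `|f x| <= M%:C) -> Cintegrable P f.
Proof.
by move=> mf; apply: Cintegrable_norm_le mf; exact: finite_measure_integrable_cst.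
Qed.

Lemma eq_Cintegral mu f g : f =1 g -> Cintegral mu f = Cintegral mu g.
Proof. by move=> /funext ->. Qed.

Lemma Cintegral_probability_cst (P : probability T R) (z : R[i]) :
  Cintegral P (fun=> z) = z.
Proof. by rewrite /Cintegral !Rintegral_probability_cst; case: z. Qed.

Lemma Cintegral_real mu (h : T -> R) :
  Cintegral mu (fun x => (h x)%:C) = (\int[mu]_x h x)%:C.
Proof. by rewrite /Cintegral/= /Rintegral integral0. Qed.

Lemma CintegrableD mu f g :
  Cintegrable mu f -> Cintegrable mu g -> Cintegrable mu (fun x => f x + g x).
Proof.
move=> [iRef iImf] [iReg iImg]; split; rewrite /comp;
  under eq_fun do rewrite raddfD.
- exact: (integrableD _ iRef iReg).
- exact: (integrableD _ iImf iImg).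
Qed.

Lemma CintegralD mu f g : Cintegrable mu f -> Cintegrable mu g ->
  Cintegral mu (fun x => f x + g x) = Cintegral mu f + Cintegral mu g.
Proof.
move=> [iRef iImf] [iReg iImg]; rewrite /Cintegral.
under eq_Rintegral do rewrite raddfD.
under [X in _ +i* X]eq_Rintegral do rewrite raddfD.
by rewrite !RintegralD.
Qed.

Lemma CintegrableZl mu (z : R[i]) f :
  Cintegrable mu f -> Cintegrable mu (fun x => z * f x).
Proof.
move=> [iRe iIm]; split; rewrite /comp.
- under eq_fun do rewrite ReM EFinB.
  by apply: integrableB => //; [exact: integrableZl iRe|exact: integrableZl iIm].
- under eq_fun do rewrite ImM EFinD.
  by apply: integrableD => //; [exact: integrableZl iIm|exact: integrableZl iRe].
Qed.

Lemma CintegralZl mu (z : R[i]) f : Cintegrable mu f ->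
  Cintegral mu (fun x => z * f x) = z * Cintegral mu f.
Proof.
move=> [iRe iIm]; have iZ (c : R) h : mu.-integrable setT (EFin \o h) ->
  mu.-integrable setT (EFin \o (fun x => c * h x)) by exact: integrableZl.
rewrite [RHS]complexE ReM ImM/= -!RintegralZl// -RintegralB//; [|exact: iZ..].
rewrite -RintegralD//; [|exact: iZ..]; simpc.
by congr (_ +i* _); apply: eq_Rintegral => x _; rewrite ?ReM ?ImM.
Qed.

Lemma Cintegral_conj mu f : Cintegrable mu f ->
  Cintegral mu (fun x => conjc (f x)) = conjc (Cintegral mu f).
Proof.
move=> [_ iIm]; rewrite /Cintegral /= -mulN1r -RintegralZl//.
by congr (_ +i* _); apply: eq_Rintegral => x _; case: (f x) => u v;
  rewrite ?mulN1r.
Qed.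

Lemma Cintegrable_sum mu (I : Type) (s : seq I) (F : I -> T -> R[i]) :
  (forall i, Cintegrable mu (F i)) ->
  Cintegrable mu (fun x => \sum_(i <- s) F i x).
Proof.
move=> iF; elim: s => [|i s IHs].
  by under eq_fun do rewrite big_nil; split; exact: integrable0.
by under eq_fun do rewrite big_cons; exact: CintegrableD.
Qed.

Lemma Cintegral_sum mu (I : Type) (s : seq I) (F : I -> T -> R[i]) :
  (forall i, Cintegrable mu (F i)) ->
  Cintegral mu (fun x => \sum_(i <- s) F i x) = \sum_(i <- s) Cintegral mu (F i).
Proof.
move=> iF; elim: s => [|i s IHs].
  rewrite big_nil; under eq_Cintegral do rewrite big_nil.
  by rewrite (Cintegral_real mu (fun=> 0)) /Rintegral integral0.
rewrite big_cons -IHs -CintegralD//; last exact: Cintegrable_sum.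
by apply: eq_Cintegral => x; rewrite big_cons.
Qed.

Lemma Cintegral_cvg mu (f_ : nat -> T -> R[i]) f (g : T -> R) :
  (forall n, Cmeasurable (f_ n)) -> Cmeasurable f ->
  (forall x, (f_ n x : R[i]^o) @[n --> \oo] --> (f x : R[i]^o)) ->
  mu.-integrable setT (EFin \o g) ->
  (forall n x, `|f_ n x| <= (g x)%:C) ->
  (Cintegral mu (f_ n) : R[i]^o) @[n --> \oo] --> (Cintegral mu f : R[i]^o).
Proof.
move=> mf_ [mRe mIm] f_f ig f_g; apply/cvg_complexP; split.
- apply: (Rintegral_cvg _ mRe _ ig) => [n|x|n x]; first by have [] := mf_ n.
    by have /cvg_complexP[] := f_f x.
  by rewrite -lecR (le_trans (normc_ge_Re _)).
- apply: (Rintegral_cvg _ mIm _ ig) => [n|x|n x]; first by have [] := mf_ n.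
    by have /cvg_complexP[] := f_f x.
  by rewrite -lecR (le_trans (normc_ge_Im _)).
Qed.

End complex_integral.

Section complex_product_integral.
Context {d1 d2 : measure_display} {T1 : measurableType d1}
  {T2 : measurableType d2} {R : realType}.
Variables (mu1 : {sigma_finite_measure set T1 -> \bar R})
  (mu2 : {sigma_finite_measure set T2 -> \bar R}).
Variables (f : T1 -> R[i]) (g : T2 -> R[i]).
Hypotheses (intf : Cintegrable mu1 f) (intg : Cintegrable mu2 g).

Lemma Cintegrable_tensor :
  Cintegrable (mu1 \x mu2)%E (fun w : T1 * T2 => f w.1 * g w.2).
Proof.
case: intf intg => [iRef iImf] [iReg iImg]; split; rewrite /comp.
- under eq_fun do rewrite ReM EFinB.
  by apply: integrableB => //;
    [exact: integrable_tensor iRef iReg|exact: integrable_tensor iImf iImg].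
- under eq_fun do rewrite ImM EFinD.
  by apply: integrableD => //;
    [exact: integrable_tensor iRef iImg|exact: integrable_tensor iImf iReg].
Qed.

Lemma Cintegral_tensor :
  Cintegral (mu1 \x mu2)%E (fun w : T1 * T2 => f w.1 * g w.2) =
  Cintegral mu1 f * Cintegral mu2 g.
Proof.
case: intf intg => [iRef iImf] [iReg iImg].
rewrite [RHS]complexE ReM ImM/= -!Rintegral_tensor// -RintegralB//; first last.
- exact: integrable_tensor iImf iImg.
- exact: integrable_tensor iRef iReg.
rewrite -RintegralD//; first last.
- exact: integrable_tensor iImf iReg.
- exact: integrable_tensor iRef iImg.
by simpc; congr (_ +i* _); apply: eq_Rintegral => w _; rewrite ?ReM ?ImM.
Qed.

End complex_product_integral.

Section density.
Context {d : measure_display} {T : measurableType d} {R : realType}.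
Variables (mu : {sigma_finite_measure set T -> \bar R}) (f : T -> R).
Hypothesis f_ge0 : forall x, 0 <= f x.
Hypothesis int_f : mu.-integrable setT (EFin \o f).
Hypothesis int_f1 : \int[mu]_x f x = 1.

Definition with_density (A : set T) : \bar R := (\int[mu]_(x in A) (f x)%:E)%E.

Let with_density0 : with_density set0 = 0%E.
Proof. exact: integral_set0. Qed.

Let with_density_ge0 A : (0 <= with_density A)%E.
Proof. by apply: integral_ge0 => x _; rewrite lee_fin. Qed.

Let with_density_sigma_additive : semi_sigma_additive with_density.
Proof.
move=> /= A mA tA mUA; rewrite /with_density integral_bigcup//=; last first.
  exact: integrableS int_f.
apply: is_cvg_ereal_nneg_natsum_cond => n _ _.
by apply: integral_ge0 => x _; rewrite lee_fin.
Qed.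

HB.instance Definition _ := isMeasure.Build _ _ _
  with_density with_density0 with_density_ge0 with_density_sigma_additive.

Let with_density_setT : with_density setT = 1%E.
Proof. by rewrite -[LHS]fineK ?(integrable_fin_num _ int_f)// [fine _]int_f1. Qed.

HB.instance Definition _ :=
  @Measure_isProbability.Build _ _ R with_density with_density_setT.

Let with_density_dominated : with_density `<< mu.
Proof.
apply/null_content_dominatesP => A mA muA0; apply: null_set_integral => //.
by apply: measurable_funTS; exact: measurable_int int_f.
Qed.

Let Rintegral_with_density (g : T -> R) : measurable_fun setT g ->
  (with_density : probability T R).-integrable setT (EFin \o g) ->
  \int[(with_density : probability T R)]_x g x = \int[mu]_x (g x * f x).
Proof.
move=> mg ig; congr fine.
rewrite -(Radon_Nikodym_change_of_variables with_density_dominated)//=.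
apply: ae_eq_integral => //.
- apply: emeasurable_funM; first exact/measurable_EFinP.
  by apply: (measurable_int mu); exact: Radon_Nikodym_integrable.
- apply/measurable_EFinP/measurable_funM => //.
  by apply/measurable_EFinP; exact: measurable_int int_f.
- under [X in ae_eq _ _ _ X]eq_fun do rewrite EFinM.
  apply: ae_eqe_mul2l; rewrite Radon_NikodymE//=; case: cid => /= h [_ int_h hE].
  apply: integral_ae_eq => //=; first exact: measurable_int int_f.
  by move=> E _ mE; rewrite -hE.
Qed.

Lemma exists_density : exists P : probability T R,
  forall (F : T -> R[i]) (M : R), Cmeasurable F -> (forall x, `|F x| <= M%:C) ->
    Cintegral P F = Cintegral mu (fun x => (f x)%:C * F x).
Proof.
exists with_density => F M mF bF.
have [iRe iIm] := @Cintegrable_bounded _ _ _ with_density _ _ mF bF.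
have [mRe mIm] := mF; rewrite /Cintegral !Rintegral_with_density//.
by congr (_ +i* _); apply: eq_Rintegral => x _;
  rewrite ?ReM ?ImM/= mul0r ?subr0 ?addr0 mulrC.
Qed.

End density.

Section series_density.
Context {d : measure_display} {T : measurableType d} {R : realType}.
Variables (P : probability T R) (a : nat -> T -> R) (b : nat -> R).
Hypothesis meas_a : forall k, measurable_fun setT (a k).
Hypothesis a0 : forall w, a 0 w = 1.
Hypothesis a_le : forall k w, `|a k w| <= b k.
Hypothesis b_cvg : cvgn (series b).
Hypothesis b_le2 : limn (series b) <= 2.
Hypothesis int_a0 : forall k, \int[P]_w a k.+1 w = 0.

Let psum n w := \sum_(k < n) a k w.
Let dens w := limn (psum ^~ w).

Let b_ge0 k : 0 <= b k.
Proof. exact: le_trans (normr_ge0 _) (a_le k point). Qed.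

Let sum_b_le2 n : \sum_(k < n) b k <= 2.
Proof.
rewrite -(big_mkord predT) (le_trans _ b_le2)//.
by apply: nondecreasing_cvgn_le b_cvg n; apply: nondecreasing_series => k _ _.
Qed.

Let psum_norm n w : `|psum n w| <= 2.
Proof.
by rewrite (le_trans _ (sum_b_le2 n))// (le_trans (ler_norm_sum _ _ _))// ler_sum.
Qed.

Let psum_ge0 n w : 0 <= psum n.+1 w.
Proof.
have tail : `|\sum_(k < n) a k.+1 w| <= 2 - b 0.
  rewrite lerBrDl (le_trans _ (sum_b_le2 n.+1))// big_ord_recl lerD2l.
  by rewrite (le_trans (ler_norm_sum _ _ _))// ler_sum.
have b0_ge1 : 1 <= b 0 by have := a_le 0 w; rewrite a0 normr1.
by rewrite /psum big_ord_recl a0; move: tail; rewrite ler_norml => /andP[+ _]; lra.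
Qed.

Let psum_cvg w : psum n w @[n --> \oo] --> dens w.
Proof.
rewrite /dens (_ : psum ^~ w = series (a ^~ w)).
  apply: normed_cvg; apply: (series_le_cvg _ b_ge0 _ b_cvg) => k /=.
    exact: normr_ge0.
  exact: a_le.
by apply/funext => n; rewrite /series/= big_mkord.
Qed.

Let meas_psum n : measurable_fun setT (psum n).
Proof. exact: measurable_sum. Qed.

Let meas_dens : measurable_fun setT dens.
Proof.
by apply: (@measurable_fun_cvg _ _ _ setT psum) => // w _; exact: psum_cvg.
Qed.

Let dens_ge0 w : 0 <= dens w.
Proof.
by apply: limr_ge; [exact: psum_cvg|exists 1 => // -[|n] //= _; exact: psum_ge0].
Qed.

Let int_cst2 : P.-integrable setT (EFin \o cst (2 : R)).
Proof. exact: finite_measure_integrable_cst. Qed.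

Let dens_le2 w : `|dens w| <= 2.
Proof.
rewrite ger0_norm//; apply: limr_le; first exact: psum_cvg.
by apply: nearW => n; exact: le_trans (ler_norm _) (psum_norm n w).
Qed.

Let int_dens1 : \int[P]_w dens w = 1.
Proof.
have int_psum n : \int[P]_w psum n.+1 w = 1.
  apply: (@complexI R); rewrite -Cintegral_real.
  have ia k : Cintegrable P (fun w => (a k w)%:C).
    apply: Cintegrable_bounded (Cmeasurable_real (meas_a k)) _ => w.
    by rewrite normc_real lecR.
  under eq_Cintegral do rewrite /psum rmorph_sum.
  rewrite (Cintegral_sum _ (fun k : 'I_n.+1 => ia k)) big_ord_recl big1 => [|k _].
    under eq_Cintegral do rewrite a0.
    by rewrite Cintegral_probability_cst addr0.
  by rewrite Cintegral_real int_a0.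
have cvg_int := Rintegral_cvg meas_psum meas_dens psum_cvg int_cst2 psum_norm.
apply: (cvg_unique _ cvg_int) => //.
by apply: cvg_near_cst; exists 1 => // -[|n] //= _; exact: int_psum.
Qed.

Lemma exists_series_density : exists P' : probability T R,
  forall (F : T -> R[i]) (M : R), Cmeasurable F -> (forall w, `|F w| <= M%:C) ->
    ((\sum_(k < n) Cintegral P (fun w => (a k w)%:C * F w) : R[i]^o)
      @[n --> \oo] --> (Cintegral P' F : R[i]^o)).
Proof.
have int_dens := integrable_bounded P meas_dens dens_le2.
have [P' P'E] := exists_density dens_ge0 int_dens int_dens1.
exists P' => F M mF bF; rewrite (P'E _ _ mF bF).
have bM (u v : R) w : `|u| <= v -> `|u%:C * F w| <= (v * M)%:C.
  by move=> uv; rewrite normrM rmorphM ler_pM// normc_real lecR.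
have maF k : Cmeasurable (fun w => (a k w)%:C * F w).
  by apply: CmeasurableM => //; exact: Cmeasurable_real.
have iaF k := Cintegrable_bounded P (maF k) (fun w => bM _ _ w (a_le k w)).
rewrite (_ : (fun n => _) =
    fun n => Cintegral P (fun w => (psum n w)%:C * F w)); last first.
  apply/funext => n; rewrite -(Cintegral_sum _ (fun k : 'I_n => iaF k)).
  by apply: eq_Cintegral => w; rewrite rmorph_sum mulr_suml.
have int_2M := finite_measure_integrable_cst P (2 * M) measurableT.
apply: Cintegral_cvg int_2M _ => [n||w|n w].
- by apply: CmeasurableM => //; exact: Cmeasurable_real.
- by apply: CmeasurableM => //; exact: Cmeasurable_real.
- by apply: cvgMr_tmp; apply: cvg_real_complex; exact: psum_cvg.
- exact: bM.
Qed.

End series_density.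

Section iid.
Context {R : realType} {d0 : measure_display} {T0 : measurableType d0}.

Record iid (P0 : probability T0 R) {d : measure_display} {T : measurableType d}
    (P : probability T R) (n : nat) (X : 'I_n -> T -> T0) : Prop := IID {
  measurable_iid : forall j, measurable_fun setT (X j);
  Cintegrable_iid : forall F : 'I_n -> T0 -> R[i],
    (forall j, Cintegrable P0 (F j)) ->
    Cintegrable P (fun w => \prod_j F j (X j w));
  Cintegral_iid : forall F : 'I_n -> T0 -> R[i],
    (forall j, Cintegrable P0 (F j)) ->
    Cintegral P (fun w => \prod_j F j (X j w)) = \prod_j Cintegral P0 (F j) }.

Lemma exists_iid (P0 : probability T0 R) (n : nat) :
  exists (d : measure_display) (T : measurableType d) (P : probability T R)
    (X : 'I_n -> T -> T0), iid P0 P X.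
Proof.
elim: n => [|n [d [T [P [X [mX iX XE]]]]]].
  exists d0, T0, P0, (fun=> id); split=> // F _.
    under eq_fun do rewrite big_ord0.
    by split; exact: finite_measure_integrable_cst.
  by rewrite big_ord0; under eq_Cintegral do rewrite big_ord0;
    exact: Cintegral_probability_cst.
pose X' (j : 'I_n.+1) (w : T0 * T) :=
  if unlift ord0 j is Some i then X i w.2 else w.1.
have X'E F w : \prod_j F j (X' j w) =
    F ord0 w.1 * \prod_i F (lift ord0 i) (X i w.2) :> R[i].
  rewrite big_ord_recl /X' unlift_none; congr (_ * _).
  by apply: eq_bigr => i _; rewrite liftK.
exists _, (T0 * T)%type, (P0 \x P)%E, X'; split=> [j|F iF|F iF].
- rewrite /X'; case: (unlift ord0 j) => [i|]; last exact: measurable_fst.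
  by apply: measurableT_comp; [exact: mX|exact: measurable_snd].
- rewrite (funext (X'E F)).
  exact: Cintegrable_tensor (iF ord0) (iX _ (fun i => iF (lift ord0 i))).
- rewrite (funext (X'E F)) big_ord_recl -XE//.
  exact: Cintegral_tensor (iF ord0) (iX _ (fun i => iF (lift ord0 i))).
Qed.

End iid.

Section exponential_partial_sums.
Context {F : numFieldType}.
Implicit Types x y : F.

Definition exp_psum x n : F := \sum_(m < n) x ^+ m / m`!%:R.

Let term x y i j : F := (x ^+ i / i`!%:R) * (y ^+ j / j`!%:R).

Let exp_term_D x y m :
  (x + y) ^+ m / m`!%:R = \sum_(i < m.+1) term x y i (m - i).
Proof.
rewrite addrC exprDn mulr_suml; apply: eq_bigr => i _.
have im : (i <= m)%N by rewrite -ltnS.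
have fact_neq0 k : k`!%:R != 0 :> F by rewrite pnatr_eq0 -lt0n fact_gt0.
have bin_neq0 : 'C(m, i)%:R != 0 :> F by rewrite pnatr_eq0 -lt0n bin_gt0.
rewrite -(bin_fact im) !natrM /term -mulr_natr; field.
by rewrite bin_neq0 !fact_neq0.
Qed.

Lemma exp_psumD x y n : exp_psum (x + y) n =
  \sum_(i < n) \sum_(j < n | (i + j < n)%N) (x ^+ i / i`!%:R) * (y ^+ j / j`!%:R).
Proof.
transitivity (\sum_(m < n) \sum_(i < n | (i <= m)%N) term x y i (m - i)).
  apply: eq_bigr => m _; rewrite exp_term_D.
  by rewrite (big_ord_widen _ (fun i => term x y i (m - i)) (ltn_ord m)).
rewrite (exchange_big_dep predT)//=; apply: eq_bigr => i _.
transitivity (\sum_(i <= m < n) term x y i (m - i)).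
  by rewrite big_geq_mkord.
rewrite -{1}(add0n i) big_addn big_mkord.
rewrite (eq_bigr (fun j : 'I_(n - i) => term x y i j)) => [|j _]; last first.
  by rewrite addnK.
rewrite (big_ord_widen n (term x y i)) ?leq_subr//.
by apply: eq_bigl => j; rewrite ltn_subRL.
Qed.

Lemma exp_psum_mulB x y n : exp_psum x n * exp_psum y n - exp_psum (x + y) n =
  \sum_(i < n) \sum_(j < n | ~~ (i + j < n)%N)
    (x ^+ i / i`!%:R) * (y ^+ j / j`!%:R).
Proof.
rewrite exp_psumD {1}/exp_psum mulr_suml -sumrB; apply: eq_bigr => i _.
rewrite /exp_psum mulr_sumr (bigID (fun j : 'I_n => (i + j < n)%N))/=.
by rewrite addrAC subrr add0r.
Qed.

Lemma exp_psum_mulB_norm x y n :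
  `|exp_psum x n * exp_psum y n - exp_psum (x + y) n| <=
  exp_psum `|x| n * exp_psum `|y| n - exp_psum (`|x| + `|y|) n.
Proof.
rewrite !exp_psum_mulB (le_trans (ler_norm_sum _ _ _))// ler_sum// => i _.
rewrite (le_trans (ler_norm_sum _ _ _))// ler_sum// => j _.
by rewrite !normrM !normfV !normrX !normr_nat.
Qed.

End exponential_partial_sums.

Section complex_exponential.
Context {R : realType}.
Implicit Types (x y : R) (z : R[i]).

Lemma exp_psum_real_complex x n : exp_psum x%:C n = (exp_psum x n)%:C.
Proof.
rewrite /exp_psum rmorph_sum; apply: eq_bigr => m _.
by rewrite rmorphM fmorphV rmorphXn rmorph_nat.
Qed.

Lemma exprc_i m :
  'i%C ^+ m =
  ((~~ odd m)%:R * (-1) ^+ m./2) +i* ((odd m)%:R * (-1) ^+ m./2) :> R[i].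
Proof.
rewrite -{1}(odd_double_half m) exprD -mul2n exprM sqr_i.
have -> : (-1) ^+ m./2 = ((-1) ^+ m./2)%:C :> R[i] by rewrite rmorphXn rmorphN1.
by case: (odd m); rewrite ?expr1 ?expr0 ?mul1r; simpc; rewrite ?mul1r ?mul0r.
Qed.

Lemma exp_psum_imaginary y n :
  exp_psum ('i%C * y%:C) n = series (cos_coeff y) n +i* series (sin_coeff y) n.
Proof.
have term m : ('i%C * y%:C) ^+ m / m`!%:R = cos_coeff y m +i* sin_coeff y m.
  have -> : (m`!%:R)^-1 = ((m`!%:R)^-1)%:C :> R[i] by rewrite fmorphV rmorph_nat.
  rewrite exprMn -rmorphXn -mulrA -rmorphM exprc_i.
  rewrite /cos_coeff /sin_coeff/=; simpc; congr (_ +i* _).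
    by rewrite -exprnP !mulrA.
  case: m => [|m]; first by rewrite !mul0r.
  by rewrite /= uphalf_half; case: (odd m); rewrite ?mul0r// !mulrA.
rewrite /exp_psum (eq_bigr _ (fun (m : 'I_n) _ => term m)) /series/= !big_mkord.
by elim/big_rec3: _ => // i u v w _ ->; simpc.
Qed.

Lemma exp_psum_cvg x : exp_psum x n @[n --> \oo] --> expR x.
Proof.
rewrite (_ : exp_psum x = series (exp_coeff x)).
  exact: is_cvg_series_exp_coeff.
by apply/funext => n; rewrite /series/= big_mkord.
Qed.

Lemma expR_le2 (x : R) : x <= 2^-1 -> expR x <= 2.
Proof.
move=> x_le; rewrite -[x]opprK expRN -[leRHS]invrK lef_pV2 ?posrE ?expR_gt0//.
by rewrite (le_trans _ (expR_ge1Dx _))//; lra.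
Qed.

Lemma exp_psum_real_complex_cvg x :
  (exp_psum x%:C n : R[i]^o) @[n --> \oo] --> ((expR x)%:C : R[i]^o).
Proof.
under eq_fun do rewrite exp_psum_real_complex.
by apply: cvg_real_complex; exact: exp_psum_cvg.
Qed.

Lemma exp_psum_imaginary_cvg y :
  (exp_psum ('i%C * y%:C) n : R[i]^o) @[n --> \oo] --> (cis y : R[i]^o).
Proof.
under eq_fun do rewrite exp_psum_imaginary; apply/cvg_complexP; split => /=.
- by rewrite cos.unlock; exact: is_cvg_series_cos_coeff.
- by rewrite sin.unlock; exact: is_cvg_series_sin_coeff.
Qed.

Lemma cexpE z : cexp z = (expR (Re z))%:C * cis (Im z).
Proof. by case: z => x y; rewrite /cis; simpc. Qed.

Lemma cexp0 : cexp (0 : R[i]) = 1.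
Proof. by rewrite cexpE expR0 cis0 mulr1. Qed.

Lemma cexp_conj z : cexp (conjc z) = conjc (cexp z).
Proof. by case: z => x y /=; rewrite cosN sinN mulrN. Qed.

Lemma cexp_inj_small z w : `|Im z| < 1 -> `|Im w| < 1 -> cexp z = cexp w -> z = w.
Proof.
case: z w => [x y] [x' y'] /= y1 y1' [ec es].
have e2 : expR x ^+ 2 = expR x' ^+ 2.
  rewrite -[LHS]mulr1 -[RHS]mulr1 -{1}(cos2Dsin2 y) -(cos2Dsin2 y').
  by rewrite !mulrDr -!exprMn ec es.
have ex : expR x = expR x'.
  by apply/eqP; rewrite -(eqrXn2 (n := 2)) ?expR_ge0//; apply/eqP.
have sy : sin y = sin y'.
  by apply: (mulfI (lt0r_neq0 (expR_gt0 x))); rewrite es ex.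
have in_sin_domain (u : R) : `|u| < 1 -> u \in `[- (pi / 2), pi / 2].
  move=> u1; rewrite in_itv/= -ler_norml (le_trans (ltW u1))// ler_pdivlMr//.
  by rewrite mul1r pi_ge2.
congr (_ +i* _); first exact: expR_inj.
by apply: sin_inj sy; exact: in_sin_domain.
Qed.

(* The failure of multiplicativity of exp_psum at x and iy is dominated by its
   failure at |x| and |y|, which tends to 0. *)
Lemma exp_psum_cvg_cexp z :
  (exp_psum z n : R[i]^o) @[n --> \oo] --> (cexp z : R[i]^o).
Proof.
case: z => x y; rewrite cexpE/= (_ : x +i* y = x%:C + 'i%C * y%:C); last by simpc.
pose product n : R[i] := exp_psum x%:C n * exp_psum ('i%C * y%:C) n.
pose defect n := exp_psum `|x| n * exp_psum `|y| n - exp_psum (`|x| + `|y|) n.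
have product_cvg :
    (product n : R[i]^o) @[n --> \oo] --> ((expR x)%:C * cis y : R[i]^o).
  rewrite /product; apply: cvgM; last exact: exp_psum_imaginary_cvg.
  exact: exp_psum_real_complex_cvg.
have defect_cvg0 : defect n @[n --> \oo] --> 0.
  rewrite -(subrr (expR (`|x| + `|y|))) {1}expRD.
  by apply: cvgB; [apply: cvgM|]; exact: exp_psum_cvg.
have defect_le n : `|product n - exp_psum (x%:C + 'i%C * y%:C) n| <= (defect n)%:C.
  rewrite (le_trans (exp_psum_mulB_norm _ _ _))// normrM normc_i mul1r !normc_real.
  by rewrite -rmorphD !exp_psum_real_complex -rmorphM -rmorphB.
rewrite -[X in _ --> X]subr0 (_ : (fun n => _) =
    fun n => product n - (product n - exp_psum (x%:C + 'i%C * y%:C) n)); last first.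
  by apply/funext => n; rewrite opprB [RHS]addrC subrK.
apply: cvgB product_cvg _.
by apply: (cvgc_dist_le defect_cvg0) => n; rewrite sub0r normrN.
Qed.

End complex_exponential.

Section real_line_calculus.
Context {R : realType}.
Local Notation mu := (@lebesgue_measure R).
Implicit Types (f F : R -> R) (a b c s x t : R).

Lemma is_derive_continuous f x df : is_derive x 1 f df -> {for x, continuous f}.
Proof.
by move=> [dfx _]; apply: differentiable_continuous; exact/derivable1_diffP.
Qed.

Lemma is_derive_affine s c x : is_derive x 1 (fun x => s * x + c) s.
Proof.
have -> : (fun x => s * x + c) = (s \*: id + cst c) :> (R -> R) by [].
by apply: is_derive_eq; rewrite addr0 /GRing.scale/= mulr1.
Qed.

Lemma is_derive_cos_affine s c x :
  is_derive x 1 (fun x => cos (s * x + c)) (- sin (s * x + c) * s).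
Proof. exact: is_derive1_comp (is_derive_affine s c x). Qed.

Lemma is_derive_sin_affine s c x :
  is_derive x 1 (fun x => sin (s * x + c)) (cos (s * x + c) * s).
Proof. exact: is_derive1_comp (is_derive_affine s c x). Qed.

Lemma integrable_segment f a b : continuous f -> mu.-integrable `[a, b] (EFin \o f).
Proof.
move=> cf; apply: continuous_compact_integrable; first exact: segment_compact.
exact: continuous_subspaceT.
Qed.

Lemma Rintegral_FTC2 f F a b : a < b -> continuous f ->
  (forall t, is_derive t 1 F (f t)) -> \int[mu]_(t in `[a, b]) f t = F b - F a.
Proof.
move=> ab cf dF.
have cF : continuous F by move=> t; exact: is_derive_continuous (dF t).
rewrite /Rintegral (@continuous_FTC2 _ f F)//.
- exact: continuous_subspaceT.
- split; first by move=> t _; have [] := dF t.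
  + by apply: cvg_at_right_filter; exact: cF.
  + by apply: cvg_at_left_filter; exact: cF.
- by move=> t _; rewrite derive1E; have [] := dF t.
Qed.

Lemma Rintegral_FTC2_line f F a b : continuous f ->
  (forall x, is_derive x 1 F (f x)) -> mu.-integrable setT (EFin \o f) ->
  F x @[x --> -oo] --> a -> F x @[x --> +oo] --> b -> \int[mu]_x f x = b - a.
Proof.
move=> cf dF intf Fa Fb.
pose A (n : nat) : R := n.+1%:R; pose f_ n := f \_ `[- A n, A n].
have A_cvg : A n @[n --> \oo] --> +oo.
  by rewrite /A (cvg_shiftS (fun n => n%:R : R)); exact: cvgr_idn.
have mf : measurable_fun setT f by exact: continuous_measurable_fun.
have f_cvg : \int[mu]_x f_ n x @[n --> \oo] --> \int[mu]_x f x.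
  apply: (@Rintegral_cvg _ _ R mu f_ f (fun x => `|f x|)) => //.
  - by move=> n; apply/measurable_restrict => //; rewrite setTI;
      exact: measurable_funTS.
  - move=> x; apply: cvg_near_cst; near=> n.
    rewrite /f_ patchE mem_set//= in_itv/= -ler_norml.
    by near: n; move/cvgryPge : A_cvg => /(_ `|x|).
  - exact: integrable_norm.
  - by move=> n x; rewrite /f_ patchE; case: ifP => // _; rewrite normr0.
have f_E n : \int[mu]_x f_ n x = F (A n) - F (- A n).
  rewrite -Rintegral_mkcond (Rintegral_FTC2 (F := F))//.
  by rewrite -subr_gt0 opprK addr_gt0.
have f_cvg' : \int[mu]_x f_ n x @[n --> \oo] --> b - a.
  under eq_fun do rewrite f_E; apply: cvgB; first exact: cvg_comp A_cvg Fb.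
  by apply: (cvg_comp _ _ _ Fa); apply/cvgNrNy.
exact: (cvg_unique _ f_cvg f_cvg').
Unshelve. all: by end_near. Qed.

Lemma oneDsqr_gt0 x : 0 < oneDsqr x.
Proof. exact: lt_le_trans ltr01 _. Qed.

Lemma cvg0_oneDsqr f c : (forall x, oneDsqr x * `|f x| <= c) ->
  f x @[x --> -oo] --> 0 /\ f x @[x --> +oo] --> 0.
Proof.
suff cvg_pinfty (g : R -> R) :
    (forall x, oneDsqr x * `|g x| <= c) -> g x @[x --> +oo] --> 0.
  move=> fc; split; last exact: cvg_pinfty.
  by apply/cvgNy_compNP/cvg_pinfty => x; have := fc (- x); rewrite /oneDsqr sqrrN.
move=> gc; apply/cvgr0Pnorm_lt => e e0; near=> x.
have x1 : 1 <= x by near: x; apply: nbhs_pinfty_ge; exact: num_real.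
have xe : c / e < x by near: x; apply: nbhs_pinfty_gt; exact: num_real.
have x_le : x * `|g x| <= c.
  rewrite (le_trans _ (gc x))// ler_wpM2r// (@le_trans _ _ (x ^+ 2))//.
    by rewrite expr2 ler_peMl// (le_trans ler01).
  by rewrite lerDr.
rewrite -(@ltr_pM2l _ x) ?(lt_le_trans ltr01)// (le_lt_trans x_le)//.
by rewrite -ltr_pdivrMr.
Unshelve. all: by end_near. Qed.

Lemma integral_oneDsqrV : (\int[mu]_x ((oneDsqr x)^-1)%:E = pi%:E)%E.
Proof.
rewrite (@ge0_symfun_integralT R (fun x : R => (oneDsqr x)^-1)) => [|x||x] /=.
- have := @integral0y_oneDsqr R; rewrite set_itvcy => ->.
  by rewrite -EFinM mulrC divfK.
- by rewrite invr_ge0 ltW ?oneDsqr_gt0.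
- exact: continuous_oneDsqrV.
- by rewrite /oneDsqr sqrrN.
Qed.

Lemma integrable_oneDsqrV : mu.-integrable setT (EFin \o (fun x => (oneDsqr x)^-1)).
Proof.
apply/integrableP; split.
  apply/measurable_EFinP; apply: continuous_measurable_fun.
  exact: continuous_oneDsqrV.
under eq_integral do rewrite /= gtr0_norm ?invr_gt0 ?oneDsqr_gt0//.
by rewrite integral_oneDsqrV ltry.
Qed.

Lemma integrable_oneDsqr_bound f c : measurable_fun setT f ->
  (forall x, oneDsqr x * `|f x| <= c) -> mu.-integrable setT (EFin \o f).
Proof.
move=> mf fc; have ic := integrableZl measurableT c integrable_oneDsqrV.
apply: (@integrable_norm_le _ _ _ mu f (fun x => c * (oneDsqr x)^-1) ic mf) => x.
by rewrite ler_pdivlMr ?oneDsqr_gt0// mulrC.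
Qed.

End real_line_calculus.

Section fourier_transform.
Context {R : realType}.
Local Notation mu := (@lebesgue_measure R).
Implicit Types (f : R -> R) (s x : R).

Definition fourier f s : R[i] := Cintegral mu (fun x => (f x)%:C * cis (s * x)).

Lemma Cintegrable_fourier f s : mu.-integrable setT (EFin \o f) ->
  Cintegrable mu (fun x => (f x)%:C * cis (s * x)).
Proof.
move=> intf; apply: (Cintegrable_norm_le (integrable_norm intf)) => [|x].
  apply: CmeasurableM.
    by apply/Cmeasurable_real/measurable_EFinP; exact: measurable_int intf.
  by apply: Cmeasurable_cis; exact: measurable_funM.
by rewrite normrM norm_cis mulr1 normc_real.
Qed.

Lemma fourierE f s : fourier f s =
  (\int[mu]_x (f x * cos (s * x))) +i* (\int[mu]_x (f x * sin (s * x))).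
Proof.
by congr (_ +i* _); apply: eq_Rintegral => x _;
  rewrite ?ReM ?ImM/= mul0r ?subr0 ?addr0.
Qed.

Section derivative.
Variables f f' : R -> R.
Hypothesis df : forall x, is_derive x 1 f (f' x).
Hypothesis cf' : continuous f'.
Hypotheses (intf : mu.-integrable setT (EFin \o f))
  (intf' : mu.-integrable setT (EFin \o f')).
Hypotheses (f_ninfty : f x @[x --> -oo] --> 0) (f_pinfty : f x @[x --> +oo] --> 0).

Let vanish (G : set_system R) (FG : Filter G) (h : R -> R) :
  f x @[x --> G] --> 0 -> (forall x, `|h x| <= 1) -> f x * h x @[x --> G] --> 0.
Proof.
move=> f0 h1; apply: norm_cvg0.
apply: (@squeeze_cvgr _ _ _ _ (cst 0) (fun x => `|f x|)).
- by apply: nearW => x; rewrite normr_ge0 normrM ler_piMr.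
- exact: cvg_cst.
- by rewrite -(normr0 R); exact: cvg_norm.
Qed.

Let integrable_mul (g h : R -> R) : mu.-integrable setT (EFin \o g) ->
  continuous h -> (forall x, `|h x| <= 1) ->
  mu.-integrable setT (EFin \o (fun x => g x * h x)).
Proof.
move=> intg ch h1; apply: (integrable_norm_le (integrable_norm intg)) => [|x].
  apply: measurable_funM; last exact: continuous_measurable_fun.
  by apply/measurable_EFinP; exact: measurable_int intg.
by rewrite normrM ler_piMr.
Qed.

Lemma Rintegral_derive_cos s c :
  \int[mu]_x (f' x * cos (s * x + c)) = s * \int[mu]_x (f x * sin (s * x + c)).
Proof.
have ccos : continuous (fun x => cos (s * x + c)).
  by move=> x; exact: is_derive_continuous (is_derive_cos_affine s c x).
have csin : continuous (fun x => sin (s * x + c)).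
  by move=> x; exact: is_derive_continuous (is_derive_sin_affine s c x).
have icos := integrable_mul intf' ccos (fun x => cos_max (s * x + c)).
have isin := integrable_mul intf csin (fun x => sin_max (s * x + c)).
have isinZ := integrableZl measurableT s isin.
apply/eqP; rewrite -RintegralZl// -subr_eq0 -RintegralB//; apply/eqP.
rewrite -[RHS](subrr 0).
apply: (@Rintegral_FTC2_line _ _ (fun x => f x * cos (s * x + c))).
- move=> x; apply: cvgB; first by apply: cvgM; [exact: cf'|exact: ccos].
  apply: cvgMl_tmp; apply: cvgM; last exact: csin.
  exact: is_derive_continuous (df x).
- move=> x; apply: is_derive_eq (is_deriveM (df x) (is_derive_cos_affine s c x)) _.
  by rewrite /GRing.scale/=; ring.
- exact: (integrableB measurableT icos isinZ).
- by apply: vanish => // x; exact: cos_max.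
- by apply: vanish => // x; exact: cos_max.
Qed.

Lemma fourier_derive s : fourier f' s = (- 'i%C * s%:C) * fourier f s.
Proof.
have [_ int_sin] := Cintegrable_fourier s intf'.
have := Rintegral_derive_cos s 0; have := Rintegral_derive_cos s (pi / 2).
under eq_Rintegral do rewrite cosDpihalf mulrN -mulN1r.
under [X in _ = _ * X]eq_Rintegral do rewrite sinDpihalf.
under [X in _ -> X = _ -> _]eq_Rintegral do rewrite addr0.
under [X in _ -> _ = _ * X -> _]eq_Rintegral do rewrite addr0.
rewrite RintegralZl// ?mulN1r => [/(canRL opprK) sinE cosE|]; last first.
  apply: eq_integrable int_sin => // x _ /=.
  by rewrite mul0r addr0.
rewrite !fourierE cosE sinE; simpc.
by congr (_ +i* _); ring.
Qed.

End derivative.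
End fourier_transform.

Section cosine_integral.
Context {R : realType}.
Local Notation mu := (@lebesgue_measure R).
Implicit Types (p : {poly R}) (c x t : R).

Definition cos_integral p c x : R :=
  \int[mu]_(t in `[0, 1]) (p.[t] * cos (x * t + c)).

Lemma integrable_poly_cos p c x :
  mu.-integrable `[0, 1] (EFin \o (fun t => p.[t] * cos (x * t + c))).
Proof.
apply: integrable_segment => t; apply: cvgM; first exact: continuous_horner.
exact: is_derive_continuous (is_derive_cos_affine _ _ _).
Qed.

Lemma cos_integral_bound p c x M :
  (forall t, 0 <= t <= 1 -> `|p.[t]| <= M) -> `|cos_integral p c x| <= M.
Proof.
move=> pM; have int_pcos := integrable_poly_cos p c x.
rewrite (le_trans (le_normr_Rintegral _ int_pcos))//.
have <- : \int[mu]_(t in `[0, 1]) M = M.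
  by rewrite Rintegral_cst//= lebesgue_measure_itv//= lte01 oppr0 addr0 mulr1.
apply: le_Rintegral => //.
- exact: integrable_norm.
- by apply: integrable_segment => t; exact: cvg_cst.
- move=> t /=; rewrite in_itv/= => /pM; apply: le_trans.
  by rewrite normrM ler_piMr// cos_max.
Qed.

Lemma poly_bounded01 p : exists M, forall t, 0 <= t <= 1 -> `|p.[t]| <= M.
Proof.
have [|u _ uM] := @EVT_max R (fun t => `|p.[t]|) 0 1 ler01.
  apply: continuous_subspaceT => t.
  by apply: continuous_comp; [exact: continuous_horner|exact: norm_continuous].
by exists `|p.[u]| => t t01; apply: uM; rewrite in_itv.
Qed.

(* cos (y + pi / 2) = - sin y, so differentiating in x shifts the phase *)
Lemma is_derive_cos_integral p c x :
  is_derive x 1 (cos_integral p c) (cos_integral ('X * p) (c + pi / 2) x).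
Proof.
pose f (u t : R) : R := p.[t] * cos (u * t + c).
have df (u t : R) : is_derive u 1 (f ^~ t) (p.[t] * (- sin (t * u + c) * t)).
  rewrite (_ : f ^~ t = p.[t] \*: (fun u => cos (t * u + c))).
    exact: is_deriveZ (is_derive_cos_affine t c u).
  by apply/funext => v; rewrite /f mulrC [v * t]mulrC mulrC.
have dfE (u t : R) : partial1of2 f u t = p.[t] * (- sin (t * u + c) * t).
  by rewrite partial1of2E; have [] := df u t.
have [M pM] := poly_bounded01 p.
have M_ge0 : 0 <= M by rewrite (le_trans _ (pM 0 _))// lexx ler01.
have nbhs_x : `]x - 1, x + 1[%classic x by rewrite /= in_itv/= ltrBlDr ltrDl ltr01.
have int_f u : `]x - 1, x + 1[%classic u -> mu.-integrable `[0, 1] (EFin \o f u).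
  by move=> _; exact: integrable_poly_cos.
have derf u t : `]x - 1, x + 1[%classic u -> `[0, 1]%classic t ->
    derivable (f ^~ t) u 1 by move=> _ _; have [] := df u t.
have f_bound u t : `]x - 1, x + 1[%classic u -> `[0, 1]%classic t ->
    `|partial1of2 f u t| <= cst M t.
  move=> _ /=; rewrite in_itv/= dfE => t01; have /andP[t0 t1] := t01.
  rewrite normrM -[leRHS]mulr1 ler_pM ?pM// normrM normrN.
  by rewrite mulr_ile1 ?sin_max// ger0_norm.
have int_M : mu.-integrable `[0, 1] (EFin \o cst M).
  by apply: integrable_segment => t; exact: cvg_cst.
apply: DeriveDef.
  exact: (@derivable_under_integral R _ _ mu f _ (measurable_itv _) _ _ _ nbhs_x
    int_f derf _ (fun=> M_ge0) int_M f_bound).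
rewrite -derive1E (@differentiation_under_integral R _ _ mu f _ (measurable_itv _)
  _ _ _ nbhs_x int_f derf _ (fun=> M_ge0) int_M f_bound).
apply: eq_Rintegral => t _.
by rewrite dfE addrA cosDpihalf hornerM hornerX [t * x]mulrC; ring.
Qed.

Lemma cos_integral_by_parts p c x :
  x ^+ 2 * cos_integral p c x =
  (p.[1] * x * sin (x + c) + p^`().[1] * cos (x + c)) -
  (p.[0] * x * sin c + p^`().[0] * cos c) - cos_integral (p^`()^`()) c x.
Proof.
pose F t := p.[t] * x * sin (x * t + c) + p^`().[t] * cos (x * t + c).
pose f t := (x ^+ 2 *: p + p^`()^`()).[t] * cos (x * t + c).
have -> : p.[1] * x * sin (x + c) + p^`().[1] * cos (x + c) = F 1.
  by rewrite /F mulr1.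
have -> : p.[0] * x * sin c + p^`().[0] * cos c = F 0 by rewrite /F mulr0 add0r.
have dF t : is_derive t 1 F (f t).
  have dp (q : {poly R}) : is_derive t 1 (horner q) q^`().[t].
    exact: is_derive_poly.
  have ds := is_derive_sin_affine x c t.
  have dc := is_derive_cos_affine x c t.
  have -> : F = (horner (x *: p) * (fun t => sin (x * t + c)) +
                 horner p^`() * (fun t => cos (x * t + c))) :> (R -> R).
    by apply/funext => u; rewrite /F !fctE hornerZ; ring.
  by apply: is_derive_eq; rewrite /f !derivZ !hornerE /GRing.scale/=; ring.
have cf : continuous f.
  move=> t; apply: cvgM; first exact: continuous_horner.
  exact: is_derive_continuous (is_derive_cos_affine _ _ _).
have int_pcos := integrable_poly_cos p c x.
rewrite -(Rintegral_FTC2 ltr01 cf dF) /cos_integral -RintegralZl//.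
rewrite -RintegralB//; [|exact: integrable_segment|exact: integrable_poly_cos].
by apply: eq_Rintegral => t _ /=; rewrite /f hornerD hornerZ; ring.
Qed.

End cosine_integral.

Section fejer_kernel.
Context {R : realType}.
Implicit Types (x t : R) (k : nat).

Definition derivative_tower (f : nat -> R -> R) :=
  forall k x, is_derive x 1 (f k) (f k.+1 x).

(* The k-th derivative of (1 - cos x) / x ^+ 2, which is the cosine transform of
   1 - t on [0, 1]. *)
Definition fejer k : R -> R :=
  cos_integral ('X^k - 'X^(k.+1))%R (k%:R * (pi / 2)).

Lemma fejer_tower : derivative_tower fejer.
Proof.
move=> k x; rewrite (_ : fejer k.+1 =
    cos_integral ('X * ('X^k - 'X^(k.+1)))%R (k%:R * (pi / 2) + pi / 2)).
  exact: is_derive_cos_integral.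
by rewrite /fejer mulrBr -!exprS -natr1 mulrDl mul1r.
Qed.

Lemma norm_exprMn_le t i m : 0 <= t <= 1 -> `|t ^+ i *+ m| <= m%:R.
Proof.
move=> /andP[t0 t1]; rewrite normrMn lerMn2r ger0_norm ?exprn_ge0//.
by rewrite exprn_ile1 ?orbT.
Qed.

Lemma norm_expr_sub_le t i j m n : 0 <= t <= 1 ->
  `|t ^+ i *+ m - t ^+ j *+ n| <= (m + n)%:R.
Proof.
by move=> t01; rewrite natrD (le_trans (ler_normB _ _))// lerD// norm_exprMn_le.
Qed.

Lemma fejer_bounded k x : `|fejer k x| <= 2.
Proof.
apply: cos_integral_bound => t t01; rewrite hornerD hornerN !hornerXn.
exact: (norm_expr_sub_le k k.+1 1 1 t01).
Qed.

Lemma fejer_quadratic_decay k x : x ^+ 2 * `|fejer k x| <= 2 * k.+1%:R ^+ 2.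
Proof.
rewrite -[x ^+ 2]ger0_norm ?sqr_ge0// -normrM cos_integral_by_parts.
set p : {poly R} := 'X^k - 'X^(k.+1).
have p0 : p.[0] * x * sin (k%:R * (pi / 2)) = 0.
  case: k @p => [|k] p; first by rewrite mul0r sin0 mulr0.
  by rewrite !hornerE !expr0n subrr !mul0r.
have p1 : p.[1] = 0 by rewrite !hornerE !expr1n subrr.
have p'_le t : 0 <= t <= 1 -> `|p^`().[t]| <= (k + k.+1)%:R.
  move=> t01; rewrite derivB !derivXn !(hornerD, hornerN, hornerMn, hornerXn).
  exact: norm_expr_sub_le.
have p''_le t : 0 <= t <= 1 -> `|p^`()^`().[t]| <= (k.-1 * k + k * k.+1)%:R.
  move=> t01; rewrite derivB !derivXn derivB !derivMn !derivXn.
  rewrite !(hornerD, hornerN, hornerMn, hornerXn) -!mulrnA.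
  exact: norm_expr_sub_le.
have p'cos t (y : R) : 0 <= t <= 1 -> `|p^`().[t] * cos y| <= (k + k.+1)%:R.
  by move=> t01; rewrite normrM (le_trans (ler_piMr _ (cos_max _)))// p'_le.
rewrite p0 p1 !mul0r !add0r (le_trans (ler_normB _ _))//.
have := cos_integral_bound (k%:R * (pi / 2)) x p''_le.
have t1 : 0 <= (1 : R) <= 1 by rewrite ler01 lexx.
have t0 : 0 <= (0 : R) <= 1 by rewrite ler01 lexx.
have boundary y1 y0 :=
  le_trans (ler_normB _ _) (lerD (p'cos _ y1 t1) (p'cos _ y0 t0)).
move=> /(lerD (boundary _ _))/le_trans; apply.
rewrite -!natrD -natrX -natrM ler_nat.
by case: (k) => //= j; nia.
Qed.

Lemma fejer_decay k x : oneDsqr x * `|fejer k x| <= 4 * 4 ^+ k.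
Proof.
have bounded := fejer_bounded k x; have decay := fejer_quadratic_decay k x.
have k2 : k.+1%:R ^+ 2 <= 4 ^+ k :> R.
  rewrite -!natrX ler_nat (_ : 4 = 2 ^ 2)%N// -expnM mulnC expnM.
  by rewrite leq_exp2r// ltn_expl.
have k1 : 1 <= 4 ^+ k :> R by rewrite exprn_ege1// ler1n.
rewrite /oneDsqr mulrDl mul1r; lra.
Qed.

Lemma fejer0E x : x ^+ 2 * fejer 0 x = 1 - cos x.
Proof.
rewrite /fejer mul0r expr0 expr1 cos_integral_by_parts !addr0 sin0 cos0.
have -> : (1 - 'X : {poly R})^`() = (- 1)%:P.
  by rewrite derivB derivX (derivC 1) sub0r polyCN.
have -> : cos_integral (- 1)%:P^`() 0 x = 0.
  rewrite derivC /cos_integral; under eq_Rintegral do rewrite horner0 mul0r.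
  by rewrite /Rintegral integral0.
by rewrite !hornerC !hornerE; ring.
Qed.

Lemma fejer0_ge0 x : 0 <= fejer 0 x.
Proof.
have [->|x0] := eqVneq x 0.
  apply: Rintegral_ge0 => t; rewrite /= in_itv/= => /andP[t0 t1].
  by rewrite !mul0r addr0 cos0 mulr1 expr0 expr1 !hornerE subr_ge0.
rewrite -(pmulr_rge0 (x := x ^+ 2)) ?exprn_even_gt0// fejer0E subr_ge0.
exact: cos_le1.
Qed.

(* Adding a translate by pi removes the zeros of the Fejer kernel. *)
Definition fejer_pair k x : R := fejer k x + fejer k (x + pi).

Lemma fejer_pair_tower : derivative_tower fejer_pair.
Proof.
move=> k x; have shift : is_derive x 1 (fun y => y + pi) 1.
  by have := is_derive_affine 1 pi x; under eq_fun do rewrite mul1r.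
have := @is_derive1_comp _ (fejer k) (fun y => y + pi) x _ _
  (fejer_tower k (x + pi)) shift.
rewrite mulr1 => dshift.
exact: is_deriveD (fejer_tower k x) dshift.
Qed.

Lemma pi_le4 : pi <= 4 :> R.
Proof. by have := pihalf_lt2 R; lra. Qed.

Lemma fejer_pair0_lower x : (16 * oneDsqr x)^-1 <= fejer_pair 0 x.
Proof.
have e1 := fejer0E x; have e2 := fejer0E (x + pi); rewrite cosDpi in e2.
have ge1 := fejer0_ge0 x; have ge2 := fejer0_ge0 (x + pi).
have x2 : 0 <= x ^+ 2 by exact: sqr_ge0.
have shift_le : (x + pi) ^+ 2 <= 2 * x ^+ 2 + 32.
  have := sqr_ge0 (x - pi); have p4 := pi_le4; have p0 := @pi_ge0 R.
  have : (pi : R) ^+ 2 <= 16 by nra.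
  by move=> ? ?; nra.
have x2_le : x ^+ 2 <= 2 * x ^+ 2 + 32 by lra.
have w1 := ler_wpM2r ge1 x2_le; have w2 := ler_wpM2r ge2 shift_le.
have sum_ge1 : 1 <= fejer_pair 0 x * (x ^+ 2 + 16) by rewrite /fejer_pair; lra.
rewrite -[leLHS]mul1r ler_pdivrMr ?mulr_gt0 ?oneDsqr_gt0//.
rewrite (le_trans sum_ge1)// ler_wpM2l ?addr_ge0// /oneDsqr; lra.
Qed.

Lemma fejer_pair0_gt0 x : 0 < fejer_pair 0 x.
Proof.
by rewrite (lt_le_trans _ (fejer_pair0_lower x)).
Qed.

Lemma fejer_pair_decay k x : oneDsqr x * `|fejer_pair k x| <= 136 * 4 ^+ k.
Proof.
have decay1 := fejer_decay k x; have decay2 := fejer_decay k (x + pi).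
have shift_le : oneDsqr x <= 33 * oneDsqr (x + pi).
  have p4 := pi_le4; have p0 := @pi_ge0 R; rewrite /oneDsqr.
  have := sqr_ge0 (x + 2 * pi); have := sqr_ge0 (x + pi).
  have : (pi : R) ^+ 2 <= 16 by nra.
  by move=> ? ? ?; nra.
have w2 := ler_wpM2r (normr_ge0 (fejer k (x + pi))) shift_le.
rewrite (le_trans (ler_wpM2l (ltW (oneDsqr_gt0 x)) (ler_normD _ _)))//.
rewrite mulrDr; lra.
Qed.

Lemma fejer_pair_dominated k x :
  `|fejer_pair k x| <= (136 * 16 * 4) ^+ k * fejer_pair 0 x.
Proof.
case: k => [|k]; first by rewrite mul1r gtr0_norm ?fejer_pair0_gt0.
have lower : 1 <= fejer_pair 0 x * (16 * oneDsqr x).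
  by rewrite -ler_pdivrMr ?mul1r ?fejer_pair0_lower// mulr_gt0 ?oneDsqr_gt0.
apply: (@le_trans _ _ (136 * 16 * 4 ^+ k.+1 * fejer_pair 0 x)).
  rewrite -(ler_pM2l (oneDsqr_gt0 x)) (le_trans (fejer_pair_decay k.+1 x))//.
  rewrite (_ : oneDsqr x * _ =
      136 * 4 ^+ k.+1 * (fejer_pair 0 x * (16 * oneDsqr x))).
    by rewrite ler_peMr// mulr_ge0// exprn_ge0.
  by ring.
rewrite exprMn ler_wpM2r ?(ltW (fejer_pair0_gt0 x))// ler_wpM2r ?exprn_ge0//.
by rewrite exprS ler_peMr ?exprn_ege1//; lra.
Qed.

End fejer_kernel.

Section score_sequence.
Context {R : realType}.

(* For X with density f, r k = f^(k) / f: the weight r k realises the Fourier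
   multiplier (- i s)^k of the k-th derivative. *)
Record score_sequence {d : measure_display} {T : measurableType d}
    (P : probability T R) (X : T -> R) (r : nat -> T -> R) (eps : R) : Prop :=
  ScoreSequence {
    measurable_score_variable : measurable_fun setT X;
    measurable_score : forall k, measurable_fun setT (r k);
    score_le : forall k w, `|r k w| <= eps ^+ k;
    score0 : forall w, r 0 w = 1;
    Cintegral_score : forall k s,
      Cintegral P (fun w => (r k w)%:C * cis (s * X w)) =
      (- 'i%C * s%:C) ^+ k * cf_of P (fun w => s * X w) }.

End score_sequence.

Section dominated_tower.
Context {R : realType}.
Local Notation mu := (@lebesgue_measure R).
Variables (f : nat -> R -> R) (K : R).
Hypothesis tower : derivative_tower f.
Hypothesis f0_gt0 : forall x, 0 < f 0 x.
Hypothesis dominated : forall k x, `|f k x| <= K ^+ k * f 0 x.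
Hypothesis int_f0 : mu.-integrable setT (EFin \o f 0).
Hypotheses (f0_ninfty : f 0 x @[x --> -oo] --> 0)
  (f0_pinfty : f 0 x @[x --> +oo] --> 0).

Lemma continuous_tower k : continuous (f k).
Proof. by move=> x; exact: is_derive_continuous (tower k x). Qed.

Lemma measurable_tower k : measurable_fun setT (f k).
Proof. by apply: continuous_measurable_fun; exact: continuous_tower. Qed.

Lemma integrable_tower k : mu.-integrable setT (EFin \o f k).
Proof.
have int_Kf0 := integrableZl measurableT (K ^+ k) int_f0.
exact: (@integrable_norm_le _ _ _ mu (f k) (fun x => K ^+ k * f 0 x) int_Kf0
  (measurable_tower k) (dominated k)).
Qed.

Lemma tower_cvg0 k (G : set_system R) (FG : Filter G) :
  f 0 x @[x --> G] --> 0 -> f k x @[x --> G] --> 0.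
Proof.
move=> f0_cvg; apply: norm_cvg0.
apply: (@squeeze_cvgr _ _ _ _ (cst 0) (fun x => K ^+ k * f 0 x)).
- by apply: nearW => x; rewrite normr_ge0 dominated.
- exact: cvg_cst.
- by rewrite -(mulr0 (K ^+ k)); exact: cvgMl_tmp.
Qed.

Lemma fourier_tower k s : fourier (f k) s = (- 'i%C * s%:C) ^+ k * fourier (f 0) s.
Proof.
elim: k => [|k IHk]; first by rewrite mul1r.
rewrite exprS -mulrA -IHk {IHk}.
apply: fourier_derive (tower k) (@continuous_tower k.+1) (integrable_tower k)
  (integrable_tower k.+1) _ _ s; exact: tower_cvg0.
Qed.

Section score.
Variable eps : R.
Hypotheses (K_gt0 : 0 < K) (eps_gt0 : 0 < eps).
Hypothesis mass_gt0 : 0 < \int[mu]_x f 0 x.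

Let mass := \int[mu]_x f 0 x.
(* Dilating by lam turns the domination constant K into eps. *)
Let lam := K / eps.
Let r k x := lam ^- k * (f k x / f 0 x).

Let lam_gt0 : 0 < lam.
Proof. exact: divr_gt0. Qed.

Let measurable_r k : measurable_fun setT (r k).
Proof.
apply: measurable_funM => //; apply: measurable_funM; first exact: measurable_tower.
apply: continuous_measurable_fun => x; apply: cvgV; first by rewrite gt_eqF.
exact: continuous_tower.
Qed.

Let r_le k x : `|r k x| <= eps ^+ k.
Proof.
rewrite normrM normfV normrX gtr0_norm// normrM normfV [`|f 0 x|]gtr0_norm//.
rewrite mulrC ler_pdivrMr ?exprn_gt0// -exprMn ler_pdivrMr//.
by rewrite (_ : eps * lam = K) ?dominated// mulrC divfK ?gt_eqF.
Qed.

Let r0 x : r 0 x = 1.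
Proof. by rewrite /r expr0 invr1 mul1r divff// gt_eqF. Qed.

Let Cintegral_r (P : probability _ R) k s :
  (forall F M, Cmeasurable F -> (forall x, `|F x| <= M%:C) ->
    Cintegral P F = Cintegral mu (fun x => (mass^-1 * f 0 x)%:C * F x)) ->
  Cintegral P (fun x => (r k x)%:C * cis (s * (lam * x))) =
  (mass^-1 / lam ^+ k)%:C * fourier (f k) (s * lam).
Proof.
move=> P_density; rewrite (P_density _ (eps ^+ k)) => [||x]; last 2 first.
- apply: CmeasurableM; first exact: Cmeasurable_real (measurable_r k).
  by apply: Cmeasurable_cis; do 2 apply: measurable_funM => //.
- by rewrite normrM norm_cis mulr1 normc_real lecR.
rewrite -CintegralZl; last by apply: Cintegrable_fourier; exact: integrable_tower.
apply: eq_Cintegral => x; rewrite [s * (lam * x)]mulrA !mulrA -!rmorphM.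
congr (_%:C * _); rewrite /r; field.
by rewrite !gt_eqF ?exprn_gt0.
Qed.

Lemma score_sequence_of_tower :
  exists (d : measure_display) (T : measurableType d) (P : probability T R)
    (X : T -> R) (r : nat -> T -> R), score_sequence P X r eps.
Proof.
have [||P P_density] := @exists_density _ _ _ mu (fun x => mass^-1 * f 0 x) _
  (integrableZl measurableT mass^-1 int_f0).
- by move=> x; rewrite mulr_ge0 ?invr_ge0 ?ltW.
- by rewrite RintegralZl// mulVf ?gt_eqF.
exists _, _, P, ( *%R lam), r; split => [||k w||k s]; first exact: measurable_funM.
- exact: measurable_r.
- exact: r_le.
- exact: r0.
have -> : cf_of P (fun x => s * (lam * x)) =
    Cintegral P (fun x => (r 0 x)%:C * cis (s * (lam * x))).
  by rewrite cf_ofE; apply: eq_Cintegral => x; rewrite r0 mul1r.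
have lam_neq0 : lam%:C ^+ k != 0.
  by rewrite expf_neq0// (inj_eq (@complexI R)) (gt_eqF lam_gt0).
have scaleE : (mass^-1 / lam ^+ k)%:C = (mass^-1)%:C / lam%:C ^+ k.
  by rewrite -rmorphXn -fmorphV -rmorphM.
have freqE : - 'i%C * (s * lam)%:C = - 'i%C * s%:C * lam%:C.
  by rewrite rmorphM mulrA.
rewrite !Cintegral_r// [fourier (f k) _]fourier_tower expr0 divr1 scaleE freqE.
rewrite [(_ * lam%:C) ^+ k]exprMn -!mulrA [RHS]mulrCA.
by congr (_ * _); rewrite mulrCA mulKf.
Qed.

End score.
End dominated_tower.

Section fejer_score.
Context {R : realType}.
Local Notation mu := (@lebesgue_measure R).

Lemma integrable_fejer_pair : mu.-integrable setT (EFin \o fejer_pair 0).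
Proof.
apply: integrable_oneDsqr_bound (fejer_pair_decay 0).
exact: measurable_tower fejer_pair_tower 0.
Qed.

Lemma Rintegral_fejer_pair_gt0 : 0 < \int[mu]_x fejer_pair 0 x :> R.
Proof.
have int_lower := integrableZl measurableT (16^-1) (@integrable_oneDsqrV R).
apply: (@lt_le_trans _ _ (\int[mu]_x (16^-1 * (oneDsqr x)^-1))).
  rewrite RintegralZl//; last exact: integrable_oneDsqrV.
  by rewrite /Rintegral integral_oneDsqrV mulr_gt0 ?invr_gt0 ?pi_gt0.
apply: le_Rintegral => //; first exact: integrable_fejer_pair.
by move=> x _; rewrite -invfM fejer_pair0_lower.
Qed.

Lemma exists_score_sequence (eps : R) : 0 < eps ->
  exists (d : measure_display) (T : measurableType d) (P : probability T R)
    (X : T -> R) (r : nat -> T -> R), score_sequence P X r eps.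
Proof.
move=> eps_gt0; have [ninfty pinfty] := cvg0_oneDsqr (@fejer_pair_decay R 0).
exact: (score_sequence_of_tower (@fejer_pair_tower R) (@fejer_pair0_gt0 R)
  (@fejer_pair_dominated R) integrable_fejer_pair ninfty pinfty _ _
  Rintegral_fejer_pair_gt0).
Qed.

End fejer_score.

Section monomial_sums.
Context {I : finType} {n : nat}.
Implicit Types (e : I -> 'I_n -> nat) (N : nat).

Lemma exprn_monomial_sum {C : comNzRingType} (c : I -> C) e (x : 'I_n -> C) N :
  (\sum_i c i * \prod_j x j ^+ e i j) ^+ N =
  \sum_(m : {ffun 'I_N -> I})
    (\prod_l c (m l)) * \prod_j x j ^+ (\sum_l e (m l) j).
Proof.
rewrite -[in LHS](card_ord N) -prodr_const bigA_distr_bigA/=.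
apply: eq_bigr => m _; rewrite big_split exchange_big/=; congr (_ * _).
by apply: eq_bigr => j _; rewrite prodrXr.
Qed.

Lemma norm_prod_le {R : realType} (F M : I -> R) :
  (forall i, `|F i| <= M i) -> `|\prod_i F i| <= \prod_i M i.
Proof.
by move=> FM; rewrite normr_prod; apply: ler_prod => i _; rewrite FM andbT.
Qed.

Lemma exists_small_scale {R : realType} (alpha : I -> R) e :
  (forall i, (\sum_j e i j)%N = 0%N -> alpha i = 0) ->
  exists2 eps : R, 0 < eps & \sum_i `|alpha i| * \prod_j eps ^+ e i j <= 2^-1.
Proof.
move=> no_const; pose A : R := \sum_i `|alpha i|.
have A_ge0 : 0 <= A by exact: sumr_ge0.
have A1_gt0 : 0 < 1 + A by rewrite ltr_wpDr.
pose eps : R := (2 * (1 + A))^-1.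
have eps_gt0 : 0 < eps by rewrite invr_gt0 mulr_gt0.
have eps_le1 : eps <= 1 by rewrite invf_le1 ?mulr_gt0//; lra.
exists eps => //; apply: (@le_trans _ _ (A * eps)).
  rewrite /A mulr_suml; apply: ler_sum => i _; rewrite prodrXr.
  case deg_i : (\sum_j e i j)%N => [|m].
    by rewrite (no_const _ deg_i) normr0 !mul0r.
  by rewrite ler_wpM2l// exprS ler_piMr ?(ltW eps_gt0)// exprn_ile1// ltW.
by rewrite /eps invfM mulrCA ler_piMr ?invr_ge0// ler_pdivrMr//; lra.
Qed.

End monomial_sums.

Section charfun_exp.
Context {R : realType} {n : nat} {I : finType}.
Variables (alpha : I -> R) (e : I -> 'I_n -> nat).

(* The symbol of the differential operator with coefficients alpha, under the
   convention that the derivative is the multiplier - i t. *)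
Definition symbol (t : 'I_n -> R) : R[i] :=
  \sum_i (alpha i)%:C * \prod_j (- 'i%C * (t j)%:C) ^+ e i j.

Hypothesis no_const : forall i, (\sum_j e i j)%N = 0%N -> alpha i = 0.

Lemma symbol0 : symbol (fun=> 0) = 0.
Proof.
rewrite /symbol big1// => i _; case deg_i : (\sum_j e i j)%N => [|m].
  by rewrite (no_const deg_i) mul0r.
by rewrite mulr0 prodrXr deg_i expr0n mulr0.
Qed.

Section weights.
Context {d0 : measure_display} {T0 : measurableType d0} (P0 : probability T0 R)
  (X0 : T0 -> R) (r : nat -> T0 -> R) (eps : R).
Hypothesis score : score_sequence P0 X0 r eps.
Hypothesis small : \sum_i `|alpha i| * \prod_j eps ^+ e i j <= 2^-1.
Context {d : measure_display} {T : measurableType d} (P : probability T R)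
  (pr : 'I_n -> T -> T0).
Hypothesis sample : iid P0 P pr.

Let phi s := cf_of P0 (fun w => s * X0 w).
Let Y (t : 'I_n -> R) w := \sum_j t j * X0 (pr j w).

Definition monomial_weight (k : 'I_n -> nat) w := \prod_j r (k j) (pr j w).

Definition power_weight N w := \sum_(m : {ffun 'I_N -> I})
  (\prod_l alpha (m l)) * monomial_weight (fun j => \sum_l e (m l) j)%N w.

Definition exp_weight N w := power_weight N w / N`!%:R.

Let measurable_Y t : measurable_fun setT (Y t).
Proof.
apply: measurable_sum => j; apply: measurable_funM => //.
apply: measurableT_comp (measurable_iid sample j).
exact: measurable_score_variable score.
Qed.

Let measurable_monomial_weight k : measurable_fun setT (monomial_weight k).
Proof.
apply: measurable_prod => j _.
apply: measurableT_comp (measurable_iid sample j).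
exact: measurable_score score _.
Qed.

Lemma measurable_exp_weight N : measurable_fun setT (exp_weight N).
Proof.
apply: measurable_funM => //; apply: measurable_sum => m.
by apply: measurable_funM => //; exact: measurable_monomial_weight.
Qed.

Lemma monomial_weight_le k w : `|monomial_weight k w| <= \prod_j eps ^+ k j.
Proof. by apply: norm_prod_le => j; exact: score_le score _ _. Qed.

Lemma exp_weight_le N w :
  `|exp_weight N w| <= exp_coeff (\sum_i `|alpha i| * \prod_j eps ^+ e i j) N.
Proof.
rewrite /exp_coeff/= exprn_monomial_sum normrM normfV normr_nat ler_wpM2r//.
rewrite (le_trans (ler_norm_sum _ _ _))//; apply: ler_sum => m _.
by rewrite normrM normr_prod ler_wpM2l ?prodr_ge0// monomial_weight_le.
Qed.

Lemma exp_weight0 w : exp_weight 0 w = 1.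
Proof.
rewrite /exp_weight fact0 divr1 /power_weight (eq_bigr (fun=> 1)) => [|m _].
  by rewrite sumr_const card_ffun card_ord expn0.
rewrite big_ord0 mul1r /monomial_weight big1// => j _.
by rewrite big_ord0 (score0 score).
Qed.

Let Cmeasurable_weight (h : T -> R) t : measurable_fun setT h ->
  Cmeasurable (fun w => (h w)%:C * cis (Y t w)).
Proof.
by move=> mh; apply: CmeasurableM; [exact: Cmeasurable_real|exact: Cmeasurable_cis].
Qed.

Let norm_weight_cis (x y : R) : `|x%:C * cis y| = `|x|%:C.
Proof. by rewrite normrM norm_cis mulr1 normc_real. Qed.

Lemma Cintegral_monomial_weight k t :
  Cintegral P (fun w => (monomial_weight k w)%:C * cis (Y t w)) =
  (\prod_j phi (t j)) * \prod_j (- 'i%C * (t j)%:C) ^+ k j.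
Proof.
pose F j w := (r (k j) w)%:C * cis (t j * X0 w).
have iF j : Cintegrable P0 (F j).
  apply: (@Cintegrable_bounded _ _ _ _ _ (eps ^+ k j)) => [|w].
    apply: CmeasurableM; first exact/Cmeasurable_real/(measurable_score score).
    by apply/Cmeasurable_cis/measurable_funM => //;
      exact: measurable_score_variable score.
  by rewrite norm_weight_cis lecR (score_le score).
transitivity (\prod_j Cintegral P0 (F j)).
  rewrite -(Cintegral_iid sample iF); apply: eq_Cintegral => w.
  by rewrite /F big_split/= -rmorph_prod -cis_sum.
rewrite -big_split/=; apply: eq_bigr => j _.
by rewrite /F (Cintegral_score score) mulrC.
Qed.

Lemma Cintegral_exp_weight N t :
  Cintegral P (fun w => (exp_weight N w)%:C * cis (Y t w)) =
  (\prod_j phi (t j)) * (symbol t ^+ N / N`!%:R).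
Proof.
pose c (m : {ffun 'I_N -> I}) : R[i] := (\prod_l alpha (m l))%:C / N`!%:R.
pose k (m : {ffun 'I_N -> I}) j := (\sum_l e (m l) j)%N.
pose F m w := (monomial_weight (k m) w)%:C * cis (Y t w).
have iF m : Cintegrable P (F m).
  apply: (@Cintegrable_bounded _ _ _ _ _ (\prod_j eps ^+ k m j)) => [|w].
    exact: Cmeasurable_weight.
  by rewrite norm_weight_cis lecR monomial_weight_le.
have -> : (fun w => (exp_weight N w)%:C * cis (Y t w)) =
    fun w => \sum_m c m * F m w.
  apply/funext => w; rewrite /exp_weight rmorphM fmorphV rmorph_nat rmorph_sum.
  rewrite !mulr_suml; apply: eq_bigr => m _.
  by rewrite rmorphM /c /F mulrA; congr (_ * _); rewrite mulrAC.
rewrite (Cintegral_sum _ (fun m => CintegrableZl (c m) (iF m))).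
rewrite exprn_monomial_sum mulr_suml mulr_sumr; apply: eq_bigr => m _.
rewrite CintegralZl// Cintegral_monomial_weight /c rmorph_prod.
by ring.
Qed.

Lemma exists_tilted_sample : exists P' : probability T R,
  forall t, cf_of P' (Y t) = (\prod_j phi (t j)) * cexp (symbol t).
Proof.
have b_cvg := @is_cvg_series_exp_coeff R (\sum_i `|alpha i| * \prod_j eps ^+ e i j).
have [||P' P'_cvg] := @exists_series_density _ _ _ P exp_weight _
  measurable_exp_weight exp_weight0 exp_weight_le b_cvg.
- exact: expR_le2.
- move=> N; apply: (@complexI R); rewrite -Cintegral_real.
  have := Cintegral_exp_weight N.+1 (fun=> 0).
  rewrite symbol0 expr0n mul0r mulr0.
  by move=> int0; apply: etrans int0; apply: eq_Cintegral => w;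
    rewrite /Y big1 ?cis0 ?mulr1// => j _; rewrite mul0r.
exists P' => t.
apply: (cvgc_unique (P'_cvg _ 1 (Cmeasurable_cis (measurable_Y t)) _)) => [w|].
  by rewrite norm_cis.
rewrite (_ : (fun N => _) = fun N => (\prod_j phi (t j)) * exp_psum (symbol t) N).
  by apply: cvgMl_tmp; exact: exp_psum_cvg_cexp.
apply/funext => N; rewrite /exp_psum mulr_sumr.
by apply: eq_bigr => k _; exact: Cintegral_exp_weight.
Qed.

End weights.

Lemma exists_charfun_exp :
  exists (d : measure_display) (T : measurableType d) (P : probability T R)
    (X : 'I_n -> T -> R) (phi : R -> R[i]),
  [/\ forall j, measurable_fun setT (X j), phi 0 = 1 &
  forall t : 'I_n -> R, cf_of P (fun w => \sum_j t j * X j w) =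
    (\prod_j phi (t j)) * cexp (symbol t)].
Proof.
have [eps eps_gt0 small] := exists_small_scale no_const.
have [d0 [T0 [P0 [X0 [r score]]]]] := exists_score_sequence eps_gt0.
have [d [T [P [pr sample]]]] := exists_iid P0 n.
have [P' P'E] := exists_tilted_sample score small sample.
exists d, T, P', (fun j w => X0 (pr j w)), (fun s => cf_of P0 (fun w => s * X0 w)).
split => // [j|].
  apply: measurableT_comp (measurable_iid sample j).
  exact: measurable_score_variable score.
rewrite cf_ofE -[RHS](Cintegral_probability_cst P0).
by apply: eq_Cintegral => w; rewrite mul0r cis0.
Qed.

End charfun_exp.

Section mpoly_eval_theory.
Context {R : realType} {n D : nat}.

Definition near_origin (Q : ('I_n -> R) -> Prop) : Prop :=
  \forall e \near (0 : R)^'+, forall t, (forall j, `|t j| <= e) -> Q t.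

Local Notation midx := {ffun 'I_n -> 'I_D.+1}.
Implicit Types (a : midx -> R[i]) (k : midx) (t : 'I_n -> R) (j : 'I_n).

Lemma multideg_eq0 k : multideg k = 0%N -> k = [ffun => ord0].
Proof.
move=> /eqP; rewrite sum_nat_eq0 => /forallP k0; apply/ffunP => j.
by apply/val_inj/eqP; rewrite ffunE; exact: k0.
Qed.

Lemma mpoly_evalN a t :
  mpoly_eval a (fun j => - t j) =
  mpoly_eval (fun k => (-1) ^+ multideg k * a k) t.
Proof.
apply: eq_bigr => k _; rewrite mulrAC mulrC; congr (_ * _).
rewrite /multideg -prodrXr mulrC -big_split/=; apply: eq_bigr => j _.
by rewrite rmorphN [LHS]exprNn mulrC.
Qed.

Lemma mpoly_eval_conj a t :
  conjc (mpoly_eval a t) = mpoly_eval (fun k => conjc (a k)) t.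
Proof.
rewrite /mpoly_eval rmorph_sum; apply: eq_bigr => k _.
rewrite rmorphM rmorph_prod; congr (_ * _); apply: eq_bigr => j _.
by rewrite rmorphXn; congr (_ ^+ _); exact: conjc_real.
Qed.

Definition axis j (s : R) : 'I_n -> R := fun l => if l == j then s else 0.

Lemma prod_axis {C : comNzRingType} (F : 'I_n -> R -> C) j s :
  (forall l, F l 0 = 1) -> \prod_l F l (axis j s l) = F j s.
Proof.
move=> F0; rewrite (bigD1 j)//= /axis eqxx big1 ?mulr1// => l lj.
by rewrite (negbTE lj).
Qed.

Lemma sum_axis (F : 'I_n -> R) j s : \sum_l axis j s l * F l = s * F j.
Proof.
rewrite (bigD1 j)//= /axis eqxx big1 ?addr0// => l lj.
by rewrite (negbTE lj) mul0r.
Qed.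

Definition axis_coef a j k : R[i] :=
  if [forall l, (l != j) ==> (k l == ord0)] then a k else 0.

Lemma mpoly_eval_axis a j t :
  mpoly_eval a (axis j (t j)) = mpoly_eval (axis_coef a j) t.
Proof.
apply: eq_bigr => k _; rewrite /axis_coef; case: ifPn => [/forallP k_axis|].
  congr (_ * _); apply: eq_bigr => l _; rewrite /axis.
  by have := k_axis l; case: eqP => [->//|_ /= /eqP ->]; rewrite !expr0.
rewrite negb_forall => /existsP[l]; rewrite negb_imply => /andP[lj kl].
have kl_gt0 : (nat_of_ord (k l) == 0%N) = false by exact: negbTE.
rewrite (bigD1 l)//= /axis (negbTE lj) (_ : 0%:C ^+ k l = 0 :> R[i]).
  by rewrite mul0r mulr0 mul0r.
by rewrite rmorph0 expr0n kl_gt0.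
Qed.

Lemma axis_coef_support1 a j k :
  [set l | nat_of_ord (k l) != 0%N]%SET = [set j]%SET -> axis_coef a j k = a k.
Proof.
move=> k_supp; rewrite /axis_coef ifT//; apply/forallP => l; apply/implyP => lj.
have : l \notin [set j]%SET by rewrite inE.
by rewrite -k_supp inE negbK.
Qed.

Lemma axis_coef_eq0 a j : a [ffun => ord0] = 0 ->
  (forall k, #|[set l | nat_of_ord (k l) != 0%N]%SET| = 1%N -> a k = 0) ->
  forall k, axis_coef a j k = 0.
Proof.
move=> a0 a1 k; rewrite /axis_coef; case: ifPn => // /forallP k_axis.
have [kj|kj] := eqVneq (k j) ord0.
  rewrite (_ : k = [ffun => ord0])//; apply/ffunP => l; rewrite ffunE.
  by have := k_axis l; case: eqP => [->//|_ /= /eqP].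
apply: a1; rewrite (_ : [set _ | _]%SET = [set j]%SET) ?cards1//.
apply/setP => l; rewrite !inE; have := k_axis l.
by case: eqP => [->|_ /= /eqP ->].
Qed.

Lemma mpoly_eval_le a t (e : R) : a [ffun => ord0] = 0 ->
  0 <= e <= 1 -> (forall j, `|t j| <= e) ->
  `|mpoly_eval a t| <= (\sum_k `|a k|) * e%:C.
Proof.
move=> a0 /andP[e0 e1] te.
rewrite /mpoly_eval (le_trans (ler_norm_sum _ _ _))// mulr_suml ler_sum// => k _.
have [k0|k0] := eqVneq (multideg k) 0%N.
  by rewrite (multideg_eq0 k0) a0 !mul0r normr0 mul0r.
rewrite normrM ler_wpM2l// normr_prod.
under eq_bigr do rewrite normrX normc_real -rmorphXn.
rewrite -rmorph_prod lecR; apply: (@le_trans _ _ (\prod_(j < n) e ^+ k j)).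
  by apply: ler_prod => j _; rewrite exprn_ge0//= lerXn2r ?nnegrE.
rewrite prodrXr -/(multideg k); case: (multideg k) k0 => // m _.
by rewrite exprS ler_piMr// exprn_ile1.
Qed.

Lemma Vandermonde_dual {F : fieldType} m (x : 'I_m -> F) : injective x ->
  exists W : 'I_m -> 'I_m -> F,
    forall i l : 'I_m, \sum_s x s ^+ i * W s l = (i == l)%:R.
Proof.
move=> xI; pose V := Vandermonde m (\row_i x i).
have V_unit : V \in unitmx.
  rewrite unitmxE det_Vandermonde unitfE prodf_seq_neq0; apply/allP => i _ /=.
  rewrite prodf_seq_neq0; apply/allP => j _; apply/implyP => ij.
  by rewrite !mxE subr_eq0 (inj_eq xI); apply: contraTneq ij => ->; rewrite ltnn.
exists (invmx V) => i l; have /matrixP/(_ i l) := mulmxV V_unit; rewrite !mxE => <-.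
by apply: eq_bigr => s _; rewrite !mxE.
Qed.

Lemma mpoly_eval_grid_eq0 a (x : 'I_D.+1 -> R) : injective x ->
  (forall s : midx, mpoly_eval a (fun j => x (s j)) = 0) -> forall k, a k = 0.
Proof.
move=> xI a0 k; have [W xW] := Vandermonde_dual (inj_comp (@complexI R) xI).
have dual (i : midx) :
    \sum_(s : midx) (\prod_j (x (s j))%:C ^+ i j) * \prod_j W (s j) (k j) =
    (i == k)%:R.
  under eq_bigr do rewrite -big_split/=.
  rewrite -(bigA_distr_bigA (fun j s => (x s)%:C ^+ i j * W s (k j)))/=.
  under eq_bigr do rewrite xW.
  have [->|/eqP ik] := eqVneq i k; first by rewrite big1// => j _; rewrite eqxx.
  have /existsP[j ij] : [exists j, i j != k j].
    rewrite -negb_forall; apply: contra_notN ik => /forallP ik.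
    by apply/ffunP => j; apply/eqP.
  by rewrite (bigD1 j)//= (negbTE ij) mul0r.
have : \sum_(s : midx) mpoly_eval a (fun j => x (s j)) * \prod_j W (s j) (k j) = 0.
  by rewrite big1// => s _; rewrite a0 mul0r.
rewrite /mpoly_eval; under eq_bigr do rewrite mulr_suml.
rewrite exchange_big/=; under eq_bigr => i _.
  under eq_bigr => s _ do rewrite -mulrA.
  rewrite -mulr_sumr dual; over.
rewrite (bigD1 k)//= eqxx mulr1 big1 ?addr0// => i /negbTE ->.
by rewrite mulr0.
Qed.

Lemma mpoly_eval_near_eq0 a :
  near_origin (fun t => mpoly_eval a t = 0) -> forall k, a k = 0.
Proof.
move=> /(filterI (nbhs_right_gt 0))/filter_ex[e [e_gt0 ae]].
pose x (i : 'I_D.+1) : R := e / i.+1%:R.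
apply: (@mpoly_eval_grid_eq0 a x) => [i j|s].
  move=> /(mulfI (lt0r_neq0 e_gt0))/invr_inj/eqP.
  by rewrite eqr_nat eqSS => /eqP/val_inj.
apply: ae => j; rewrite normf_div !gtr0_norm// ler_pdivrMr//.
by rewrite ler_peMr ?ler1n ?ltW.
Qed.

End mpoly_eval_theory.

Section characteristic_functions.
Context {d : measure_display} {T : measurableType d} {R : realType}.
Variable P : probability T R.

Lemma cf_ofN (Y : T -> R) : measurable_fun setT Y ->
  cf_of P (fun w => - Y w) = conjc (cf_of P Y).
Proof.
move=> mY; rewrite !cf_ofE -Cintegral_conj; last first.
  apply: (@Cintegrable_bounded _ _ _ P _ 1 (Cmeasurable_cis mY)) => w.
  by rewrite norm_cis.
by apply: eq_Cintegral => w; rewrite cisN.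
Qed.

Lemma charfunN (X : {RV P >-> R}) s : charfun X (- s) = conjc (charfun X s).
Proof.
rewrite -cf_ofN; last exact: measurable_funM.
by congr cf_of; apply/funext => w; rewrite mulNr.
Qed.

Lemma charfun0 (X : {RV P >-> R}) : charfun X 0 = 1.
Proof.
rewrite /charfun cf_ofE -[RHS](Cintegral_probability_cst P).
by apply: eq_Cintegral => w; rewrite mul0r cis0.
Qed.

Lemma charfun_vecN n (X : 'I_n -> {RV P >-> R}) t :
  charfun_vec X (fun j => - t j) = conjc (charfun_vec X t).
Proof.
rewrite -cf_ofN; last by apply: measurable_sum => j; exact: measurable_funM.
congr cf_of; apply/funext => w; rewrite -sumrN.
by apply: eq_bigr => j _; rewrite mulNr.
Qed.

Lemma charfun_vec_axis n (X : 'I_n -> {RV P >-> R}) (j : 'I_n) s :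
  charfun_vec X (axis j s) = charfun (X j) s.
Proof. by congr cf_of; apply/funext => w; rewrite sum_axis. Qed.

Lemma Re_charfun_cvg (X : {RV P >-> R}) :
  Re (charfun X s) @[s --> (0 : R)] --> (1 : R).
Proof.
have int_cos s : P.-integrable setT (EFin \o (fun w => cos (s * X w))).
  apply: (@integrable_bounded _ _ _ _ _ 1) => [|w]; last exact: cos_max.
  have msX := measurable_funM (measurable_cst s) (measurable_funPT X).
  by case: (Cmeasurable_cis msX).
have -> : (1 : R) = Re (charfun X 0) by rewrite charfun0.
apply: (@continuity_under_integral R _ _ P (fun s w => cos (s * X w)) setT
  measurableT (-1) 1 _ _ (cst 1)).
- by move=> s _; exact: int_cos.
- apply: aeW => w _ s _; apply: continuous_comp; last exact: continuous_cos.
  exact: mulrr_continuous.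
- exact: finite_measure_integrable_cst.
- by move=> s _; apply: aeW => w _; exact: cos_max.
- by rewrite inE/= in_itv/= ltrN10 ltr01.
Qed.

Lemma charfun_neq0_near (X : {RV P >-> R}) :
  \forall s \near (0 : R), charfun X s != 0.
Proof.
near=> s; have : 0 < Re (charfun X s).
  by near: s; exact: (cvgr_gt 1 (Re_charfun_cvg X)).
by apply: contraTneq => ->; rewrite ltxx.
Unshelve. all: by end_near. Qed.

End characteristic_functions.

Definition Q_independent {d : measure_display} {T : measurableType d} {R : realType}
    {P : probability T R} {n D : nat} (X : 'I_n -> {RV P >-> R})
    (a : {ffun 'I_n -> 'I_D.+1} -> R[i]) : Prop :=
  forall t : 'I_n -> R, charfun_vec X t =
    (\prod_(j < n) charfun (X j) (t j)) * cexp (mpoly_eval a t).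

Section necessity.
Context {R : realType} {n D : nat}.
Local Notation midx := {ffun 'I_n -> 'I_D.+1}.
Variables (a : midx -> R[i]) (a0 : a [ffun => ord0] = 0).
Context {d : measure_display} {T : measurableType d} (P : probability T R)
  (X : 'I_n -> {RV P >-> R}).
Hypothesis X_indep : Q_independent X a.

Lemma charfun_neq0_near_origin :
  near_origin (fun t => forall j, charfun (X j) (t j) != 0).
Proof.
suff : \forall e \near (0 : R)^'+, forall j s, `|s| <= e -> charfun (X j) s != 0.
  by apply: filterS => e Xe t te j; exact: Xe.
apply: filter_forall => j; have [e /= e_gt0 Xe] := charfun_neq0_near (X j).
near=> u => s su; apply: Xe; rewrite /ball_/= sub0r normrN (le_lt_trans su)//.
Unshelve. all: by end_near. Qed.

Lemma Im_mpoly_eval_near_origin :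
  near_origin (fun t => `|Im (mpoly_eval a t)| < 1).
Proof.
pose A : R := Re (\sum_k `|a k|).
have AE : \sum_k `|a k| = A%:C.
  by rewrite RRe_real// rpred_sum// => k _; exact: normr_real.
have A1_gt0 : 0 < 1 + A by rewrite ltr_wpDr// -lecR -AE sumr_ge0.
rewrite /near_origin; near=> e => t te.
have e_gt0 : 0 < e by near: e; exact: nbhs_right_gt.
have e_le1 : e <= 1 by near: e; exact: nbhs_right_le.
have e_lt : e < (1 + A)^-1 by near: e; apply: nbhs_right_lt; rewrite invr_gt0.
rewrite -ltcR (le_lt_trans (normc_ge_Im _))//.
have e01 : 0 <= e <= 1 by rewrite ltW.
rewrite (le_lt_trans (mpoly_eval_le a0 e01 te))// AE -rmorphM ltcR.
rewrite (@le_lt_trans _ _ ((1 + A) * e))//; first by rewrite ler_wpM2r ?ltW// ltrDr.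
by rewrite -ltr_pdivlMl// mulr1.
Unshelve. all: by end_near. Qed.

Lemma Q_independent_axis_coef (k : midx) :
  #|[set j | nat_of_ord (k j) != 0%N]%SET| = 1%N -> a k = 0.
Proof.
move=> /eqP/cards1P[j kj]; rewrite -(axis_coef_support1 a kj).
apply: (mpoly_eval_near_eq0 (a := axis_coef a j)).
apply: (@filterS2 _ (0 : R)^'+ _ _ _ _ _ charfun_neq0_near_origin
  Im_mpoly_eval_near_origin).
move=> e X_neq0 Im_small t te.
have axis_le l : `|axis j (t j) l| <= e.
  rewrite /axis; case: eqP => // _; rewrite normr0.
  exact: le_trans (te j).
rewrite -mpoly_eval_axis; apply: cexp_inj_small; first exact: Im_small.
  by rewrite normr0.
have := X_indep (axis j (t j)); rewrite charfun_vec_axis.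
rewrite (prod_axis (F := fun l => charfun (X l))) => [|l]; last exact: charfun0.
rewrite cexp0 -[LHS]mulr1 => /(mulfI _) <- //; exact: X_neq0.
Qed.

Lemma Q_independent_coef_parity (k : midx) :
  if odd (multideg k) then cRe (a k) = 0 else cIm (a k) = 0.
Proof.
pose b (k : midx) := (-1) ^+ multideg k * a k - conjc (a k).
have : b k = 0.
  apply: mpoly_eval_near_eq0 k.
  apply: (@filterS2 _ (0 : R)^'+ _ _ _ _ _ charfun_neq0_near_origin
  Im_mpoly_eval_near_origin).
  move=> e X_neq0 Im_small t te.
  have -> : mpoly_eval b t = mpoly_eval a (fun j => - t j) - conjc (mpoly_eval a t).
    rewrite mpoly_evalN mpoly_eval_conj /mpoly_eval -sumrB.
    by apply: eq_bigr => k _; rewrite -mulrBl.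
  apply/eqP; rewrite subr_eq0; apply/eqP; apply: cexp_inj_small.
  - by apply: Im_small => j; rewrite normrN.
  - by case: (mpoly_eval a t) (Im_small t te) => x y /=; rewrite normrN.
  have prod_neq0 : conjc (\prod_(j < n) charfun (X j) (t j)) != 0.
    by rewrite conjc_eq0; apply/prodf_neq0 => j _; exact: X_neq0.
  have conj_vecE : conjc (charfun_vec X t) =
      conjc (\prod_(j < n) charfun (X j) (t j)) *
      conjc (cexp (mpoly_eval a t)) by rewrite X_indep; exact: rmorphM.
  rewrite cexp_conj; apply: (mulfI prod_neq0).
  rewrite -conj_vecE -charfun_vecN X_indep.
  congr (_ * _); rewrite rmorph_prod; apply: eq_bigr => j _.
  by rewrite [RHS]charfunN.
rewrite /b -signr_odd; case: (a k) => u v; case: (odd _) => /=.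
  by rewrite expr1 mulN1r => -[h _]; lra.
by rewrite expr0 mul1r => -[_ h]; lra.
Qed.

End necessity.

Section sufficiency.
Context {R : realType} {n D : nat}.
Local Notation midx := {ffun 'I_n -> 'I_D.+1}.
Variables (a : midx -> R[i]) (a0 : a [ffun => ord0] = 0).
Hypothesis a_axis : forall k : midx,
  #|[set j | nat_of_ord (k j) != 0%N]%SET| = 1%N -> a k = 0.
Hypothesis a_parity : forall k : midx,
  if odd (multideg k) then cRe (a k) = 0 else cIm (a k) = 0.

Definition operator_coef (k : midx) : R := Re (a k * 'i%C ^+ multideg k).

Lemma operator_coefE k : a k = (operator_coef k)%:C * (- 'i%C) ^+ multideg k.
Proof.
have -> : (operator_coef k)%:C = a k * 'i%C ^+ multideg k.
  rewrite /operator_coef exprc_i; have := a_parity k.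
  by case: (odd _) (a k) => -[u v] /= ->; simpc.
by rewrite -mulrA -exprMn mulrN -expr2 sqr_i opprK expr1n mulr1.
Qed.

Lemma symbol_operator_coef t :
  symbol operator_coef (fun k j => nat_of_ord (k j)) t = mpoly_eval a t.
Proof.
apply: eq_bigr => k _; rewrite operator_coefE -mulrA; congr (_ * _).
by rewrite /multideg -prodrXr -big_split/=; apply: eq_bigr => j _; rewrite exprMn.
Qed.

Lemma mpoly_eval_axis_eq0 j s : mpoly_eval a (axis j s) = 0.
Proof.
rewrite (mpoly_eval_axis a j (fun=> s)) /mpoly_eval big1// => k _.
by rewrite (axis_coef_eq0 j a0 a_axis) mul0r.
Qed.

Lemma exists_Q_independent :
  exists (d : measure_display) (T : measurableType d) (P : probability T R)
    (X : 'I_n -> {RV P >-> R}), Q_independent X a.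
Proof.
have [k k0|d [T [P [X [phi [mX phi0 XE]]]]]] :=
    @exists_charfun_exp _ _ _ operator_coef (fun k j => nat_of_ord (k j)).
  by rewrite /operator_coef (multideg_eq0 k0) a0 mul0r.
pose Y j : {RV P >-> R} := mfun_Sub (mem_set (mX j)).
have YE t : charfun_vec Y t = (\prod_j phi (t j)) * cexp (mpoly_eval a t).
  by rewrite -symbol_operator_coef -XE.
have phiE j s : charfun (Y j) s = phi s.
  rewrite -charfun_vec_axis YE mpoly_eval_axis_eq0 cexp0 mulr1.
  by rewrite (prod_axis (F := fun=> phi)).
by exists d, T, P, Y => t; rewrite YE; under [in RHS]eq_bigr do rewrite phiE.
Qed.

End sufficiency.

Local Close Scope classical_set_scope.
Unset Implicit Arguments.

Theorem theorem1 (R : realType) (n : nat) (n_ge1 : (1 <= n)%N) (D : nat)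
  (a : {ffun 'I_n -> 'I_D.+1} -> R[i])
  (a0 : a [ffun => ord0] = 0) :
  (exists (d : measure_display) (T : measurableType d) (P : probability T R)
          (X : 'I_n -> {RV P >-> R}),
     forall t : 'I_n -> R,
       charfun_vec X t =
       (\prod_(j < n) charfun (X j) (t j)) * cexp (mpoly_eval a t))
  <->
  ((forall k : {ffun 'I_n -> 'I_D.+1},
      #|[set j | nat_of_ord (k j) != 0%N]| = 1%N -> a k = 0)
   /\
   (forall k : {ffun 'I_n -> 'I_D.+1},
      if odd (multideg k) then cRe (a k) = 0 else cIm (a k) = 0)).
Proof.
split=> [[d [T [P [X X_indep]]]]|[a_axis a_parity]].
  split=> k; first exact: (Q_independent_axis_coef a0 X_indep).
  exact: (Q_independent_coef_parity a0 X_indep).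
exact: exists_Q_independent.
Qed.
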